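(* Let $\sigma\ge1$, $\mu\ge1/2$, and let $(u(k,\cdot))_{k\in\mathbb{Z}^m}$ be a sequence in $\mathcal{S}'_\mu(\mathbb{R}^n)$ such that for every $C_1,\varepsilon>0$ there exists $\tilde C_0=\tilde C_0(\varepsilon,C_1)>0$ with $$|\langle u(k,x),f(x)\rangle|\leq\tilde C_0\|f\|_{\mu,C_1}e^{\varepsilon|k|^{1/\sigma}}\quad\text{for every } f\in\mathcal{S}_\mu(\mathbb{R}^n),\ k\in\mathbb{Z}^m.$$ Then there exists a unique $\check u\in\mathcal{S}'_{\sigma,\mu}(\mathbb{T}^m\times\mathbb{R}^n)$ such that $$\langle\check u,f\rangle=(2\pi)^m\sum_{k\in\mathbb{Z}^m}\langle u(k,x),\widehat f(-k,x)\rangle=\sum_{k\in\mathbb{Z}^m}\int_{\mathbb{T}^m}\langle u(k,x),f(t,x)\rangle e^{ik\cdot t}\,dt$$ for all $f\in\mathcal{S}_{\sigma,\mu}(\mathbb{T}^m\times\mathbb{R}^n)$.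
   Context: $\mathbb{T}^m=(\mathbb{R}/2\pi\mathbb{Z})^m$. For $C>0$, $\|f\|_{\mu,C}=\sup_{\alpha,\beta\in\mathbb{N}_0^n}C^{-|\alpha+\beta|}(\alpha!\beta!)^{-\mu}\sup_{x\in\mathbb{R}^n}|x^\alpha\partial_x^\beta f(x)|$ (possibly $+\infty$); $\mathcal{S}_\mu(\mathbb{R}^n)$ is the space of $f\in C^\infty(\mathbb{R}^n)$ with $\|f\|_{\mu,C}<\infty$ for some $C>0$, with the inductive limit topology, and $\mathcal{S}'_\mu(\mathbb{R}^n)$ is its dual. $\mathcal{S}_{\sigma,\mu,C}(\mathbb{T}^m\times\mathbb{R}^n)$ is the Banach space of $\varphi\in C^\infty(\mathbb{T}^m\times\mathbb{R}^n)$ with $$\sup_{\alpha,\beta\in\mathbb{N}_0^n}\sup_{\gamma\in\mathbb{N}_0^m}C^{-|\alpha+\beta|-|\gamma|}\gamma!^{-\sigma}(\alpha!\beta!)^{-\mu}\sup_{(t,x)}|x^\alpha\partial_x^\beta\partial_t^\gamma\varphi(t,x)|<\infty;$$ $\mathcal{S}_{\sigma,\mu}(\mathbb{T}^m\times\mathbb{R}^n)=\bigcup_{C>0}\mathcal{S}_{\sigma,\mu,C}$ with the inductive limit topology (a sequence converges iff it lies in and converges in some $\mathcal{S}_{\sigma,\mu,C}$), and $\mathcal{S}'_{\sigma,\mu}(\mathbb{T}^m\times\mathbb{R}^n)$ is the space of (sequentially) continuous linear functionals on it. For $f\in\mathcal{S}_{\sigma,\mu}(\mathbb{T}^m\times\mathbb{R}^n)$,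 $\widehat f(k,x)=\frac1{(2\pi)^m}\int_{[0,2\pi]^m}f(t,x)e^{-ik\cdot t}\,dt$. *)

(* Defs.v *)
From HB Require Import structures.
From mathcomp Require Import all_boot all_order all_algebra finmap.
From mathcomp Require Import all_classical all_reals all_analysis.
From mathcomp Require Import complex summability.
Set Implicit Arguments.
Unset Strict Implicit.
Unset Printing Implicit Defensive.
Import Order.TTheory GRing.Theory Num.Theory numFieldNormedType.Exports.
Local Open Scope classical_set_scope.
Local Open Scope ring_scope.

Section MultiIndex.
Context {R : realType}.

Definition mindex d := {ffun 'I_d -> nat}.

Definition mabs d (a : mindex d) : nat := (\sum_i a i)%N.
Definition mfact d (a : mindex d) : nat := (\prod_i (a i)`!)%N.
Definition mpow d (x : 'rV[R]_d) (a : mindex d) : R := \prod_i x 0 i ^+ a i.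

Definition pderiv d (i : 'I_d) (g : 'rV[R]_d -> R) : 'rV[R]_d -> R :=
  fun x => 'D_(delta_mx 0 i) g x.

Definition pderivs d (s : seq 'I_d) (g : 'rV[R]_d -> R) : 'rV[R]_d -> R :=
  foldr (@pderiv d) g s.

(* The multi-index b as a list of directions; [e] embeds the n variables
   concerned into the d variables of the function. *)
Definition mdirs n d (e : 'I_n -> 'I_d) (b : mindex n) : seq 'I_d :=
  flatten [seq nseq (b i) (e i) | i <- enum 'I_n].

Definition rsmooth d (g : 'rV[R]_d -> R) : Prop :=
  forall s : seq 'I_d, continuous (pderivs s g) /\
    forall i x, derivable (pderivs s g) x (delta_mx 0 i).

Definition smooth d (f : 'rV[R]_d -> R[i]^o) : Prop :=
  rsmooth (fun x => complex.Re (f x)) /\ rsmooth (fun x => complex.Im (f x)).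

Definition cderivs d (s : seq 'I_d) (f : 'rV[R]_d -> R[i]^o) (x : 'rV[R]_d) :
    R[i] :=
  (pderivs s (fun y => complex.Re (f y)) x +i* pderivs s (fun y => complex.Im (f y)) x)%C.

Definition weighted_sup (I X : Type) (w : I -> R) (g : I -> X -> R[i]) :
    \bar R :=
  ereal_sup (range (fun i => (w i)%:E *
    ereal_sup (range (fun x => (ComplexField.Normc.normc (g i x))%:E))))%E.

End MultiIndex.

Section MultiIndexTheory.
Context {R : realType}.
Import ComplexField.Normc.

Lemma pderivs_lin d (s : seq 'I_d) (a : R) (g h : 'rV[R]_d -> R) :
  rsmooth g -> rsmooth h ->
  pderivs s (fun x => a * g x + h x) =
  (fun x => a * pderivs s g x + pderivs s h x).
Proof.
move=> sg sh; elim: s => //= i s ->; apply/funext => x.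
rewrite /pderiv; have [_ dg] := sg s; have [_ dh] := sh s.
have -> : (fun x0 => a * pderivs s g x0 + pderivs s h x0) =
  (a *: (pderivs s g : _ -> R^o)) + (pderivs s h : _ -> R^o) by apply/funext.
by rewrite deriveD ?deriveZ //; exact: derivableZ.
Qed.

Lemma rsmooth_lin d (a : R) (g h : 'rV[R]_d -> R) :
  rsmooth g -> rsmooth h -> rsmooth (fun x => a * g x + h x).
Proof.
move=> sg sh s; rewrite pderivs_lin //.
have [cg dg] := sg s; have [ch dh] := sh s.
have -> : (fun x0 => a * pderivs s g x0 + pderivs s h x0) =
  (a *: (pderivs s g : _ -> R^o)) + (pderivs s h : _ -> R^o) by apply/funext.
split; last by move=> i x; apply: derivableD => //; exact: derivableZ.
by move=> x; apply: continuousD; [apply: continuousZr; exact: cg|exact: ch].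
Qed.

Lemma pderivs0 d (s : seq 'I_d) : pderivs s (fun=> 0 : R) = (fun=> 0).
Proof.
by elim: s => //= i s ->; apply/funext => x; exact: derive_cst.
Qed.

Lemma rsmooth0 d : rsmooth (fun _ : 'rV[R]_d => 0 : R).
Proof.
move=> s; rewrite pderivs0; split; first exact: cst_continuous.
by move=> i x; exact: derivable_cst.
Qed.

Lemma Re_lin (a z w : R[i]) :
  complex.Re (a * z + w) =
  - complex.Im a * complex.Im z + (complex.Re a * complex.Re z + complex.Re w).
Proof.
by case: a z w => [a1 a2] [z1 z2] [w1 w2] /=; rewrite mulNr addrA (addrC (- _)).
Qed.

Lemma Im_lin (a z w : R[i]) :
  complex.Im (a * z + w) =
  complex.Im a * complex.Re z + (complex.Re a * complex.Im z + complex.Im w).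
Proof.
by case: a z w => [a1 a2] [z1 z2] [w1 w2] /=; rewrite addrA (addrC (a1 * _)).
Qed.

Lemma smooth0 d : smooth (0 : 'rV[R]_d -> R[i]^o).
Proof. split; exact: (@rsmooth0 d). Qed.

Lemma cderivs0 d (s : seq 'I_d) x : cderivs s (0 : 'rV[R]_d -> R[i]^o) x = 0.
Proof. by rewrite /cderivs /= !pderivs0. Qed.

Lemma smooth_lin d (a : R[i]) (f g : 'rV[R]_d -> R[i]^o) :
  smooth f -> smooth g -> smooth (a *: f + g).
Proof.
move=> [rf If] [rg Ig]; split.
- under eq_fun do rewrite Re_lin.
  by do 2 (apply: rsmooth_lin => //).
- under eq_fun do rewrite Im_lin.
  by do 2 (apply: rsmooth_lin => //).
Qed.

Lemma cderivs_lin d (s : seq 'I_d) (a : R[i]) (f g : 'rV[R]_d -> R[i]^o) x :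
  smooth f -> smooth g ->
  cderivs s (a *: f + g) x = a * cderivs s f x + cderivs s g x.
Proof.
move=> [rf If] [rg Ig]; rewrite /cderivs.
under eq_fun do rewrite Re_lin.
under [X in (_ +i* pderivs _ X _)%C]eq_fun do rewrite Im_lin.
rewrite !pderivs_lin //; try exact: rsmooth_lin.
apply/eqP; rewrite eq_complex Re_lin Im_lin /=.
by rewrite !eqxx.
Qed.

Lemma weighted_sup_le (I X : Type) (w : I -> R) (g : I -> X -> R[i]) (M : R) :
  (forall i, 0 < w i) -> (forall i x, w i * normc (g i x) <= M) ->
  (weighted_sup w g <= M%:E)%E.
Proof.
move=> w0 gM; apply: ge_ereal_sup => _ [i _ <-].
have -> : (M%:E = (w i)%:E * ((w i)^-1 * M)%:E)%E.
  by rewrite -EFinM mulrA divff ?mul1r // gt_eqF.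
apply: lee_wpmul2l; first by rewrite lee_fin ltW.
apply: ge_ereal_sup => _ [x _ <-].
by rewrite lee_fin ler_pdivlMl.
Qed.

Lemma weighted_supP (I X : Type) (w : I -> R) (g : I -> X -> R[i]) :
  (forall i, 0 < w i) ->
  ((weighted_sup w g < +oo)%E <->
   exists M, forall i x, w i * normc (g i x) <= M).
Proof.
move=> w0; split; last first.
  by case=> M /(weighted_sup_le w0)/le_lt_trans; apply; exact: ltry.
move=> fin.
have ub i x : ((w i * normc (g i x))%:E <= weighted_sup w g)%E.
  apply: le_trans; last by apply: ereal_sup_ubound; exists i.
  rewrite EFinM; apply: lee_wpmul2l; first by rewrite lee_fin ltW.
  by apply: ereal_sup_ubound; exists x.
case: (weighted_sup w g) fin ub => [M| |] // _ ub.
- by exists M => i x; rewrite -lee_fin.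
- by exists 0 => i x; have := ub i x; rewrite leeNy_eq.
Qed.

Lemma weighted_sup_lin (I X : Type) (w1 w2 w : I -> R)
    (g1 g2 g : I -> X -> R[i]) (a : R[i]) :
  (forall i, 0 < w i) -> (forall i, w i <= w1 i) -> (forall i, w i <= w2 i) ->
  (forall i x, g i x = a * g1 i x + g2 i x) ->
  (weighted_sup w1 g1 < +oo)%E -> (weighted_sup w2 g2 < +oo)%E ->
  (weighted_sup w g < +oo)%E.
Proof.
move=> w0 ww1 ww2 gE.
move=> /weighted_supP-/(_ (fun i => lt_le_trans (w0 i) (ww1 i)))[M1 b1].
move=> /weighted_supP-/(_ (fun i => lt_le_trans (w0 i) (ww2 i)))[M2 b2].
apply/weighted_supP => //; exists (normc a * M1 + M2) => i x; rewrite gE.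
have n0 (z : R[i]) : 0 <= normc z by case: z => ? ?; exact: sqrtr_ge0.
apply: le_trans (_ : w i * (normc a * normc (g1 i x) + normc (g2 i x)) <= _).
  by rewrite ler_pM2l //; apply: le_trans (le_normcD _ _) _; rewrite normcM.
rewrite mulrDr mulrCA lerD //.
- apply: ler_wpM2l; first exact: n0.
  by apply: le_trans (b1 i x); apply: ler_wpM2r.
- by apply: le_trans (b2 i x); apply: ler_wpM2r.
Qed.

End MultiIndexTheory.

Section GelfandShilov.
Context {R : realType}.
Variables (n : nat) (mu : R).

Definition gs_norm (C : R) (f : 'rV[R]_n -> R[i]^o) : \bar R :=
  weighted_sup
    (fun ab : mindex n * mindex n =>
       C ^- (mabs ab.1 + mabs ab.2)
       * ((mfact ab.1 * mfact ab.2)%:R `^ (- mu)))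
    (fun ab x => (mpow x ab.1)%:C%C * cderivs (mdirs id ab.2) f x).

Definition GS : {pred 'rV[R]_n -> R[i]^o} :=
  [pred f | `[< smooth f /\ exists2 C, 0 < C & (gs_norm C f < +oo)%E >]].

Record gs := MkGs { gs_val :> 'rV[R]_n -> R[i]^o; _ : gs_val \in GS }.

End GelfandShilov.

Section GelfandShilovTorus.
Context {R : realType}.
Variables (m n : nat) (sigma mu : R).

(* Functions on T^m x R^n are functions of [row_mx t x] that are 2 pi-periodic
   in each of the m coordinates of t. *)
Definition periodic (f : 'rV[R]_(m + n) -> R[i]^o) : Prop :=
  forall (i : 'I_m) z, f (z + (2 * pi) *: delta_mx 0 (lshift n i)) = f z.

Definition tgs_norm (C : R) (f : 'rV[R]_(m + n) -> R[i]^o) : \bar R :=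
  weighted_sup
    (fun abc : mindex n * mindex n * mindex m =>
       C ^- (mabs abc.1.1 + mabs abc.1.2 + mabs abc.2)
       * ((mfact abc.2)%:R `^ (- sigma))
       * ((mfact abc.1.1 * mfact abc.1.2)%:R `^ (- mu)))
    (fun abc z => (mpow (rsubmx z) abc.1.1)%:C%C *
       cderivs (mdirs (@rshift m n) abc.1.2 ++ mdirs (@lshift m n) abc.2) f z).

Definition TGS : {pred 'rV[R]_(m + n) -> R[i]^o} :=
  [pred f | `[< [/\ smooth f, periodic f &
                 exists2 C, 0 < C & (tgs_norm C f < +oo)%E] >]].

Record tgs := MkTgs { tgs_val :> 'rV[R]_(m + n) -> R[i]^o; _ : tgs_val \in TGS }.

End GelfandShilovTorus.

Section Linear.
Context {R : realType}.
Import ComplexField.Normc.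

Lemma mfact_gt0 d (a : mindex d) : (0 < mfact a)%N.
Proof. by rewrite prodn_gt0 // => i; exact: fact_gt0. Qed.

Lemma exprVn_anti (C D : R) (k : nat) : 0 < C -> C <= D -> D ^- k <= C ^- k.
Proof.
move=> C0 CD; have D0 := lt_le_trans C0 CD.
by rewrite lef_pV2 ?posrE ?exprn_gt0 // lerXn2r ?nnegrE // ltW.
Qed.

Lemma GS_submod n (mu : R) : submod_closed (@GS R n mu).
Proof.
have w0 C (ab : mindex n * mindex n) : 0 < C ->
    0 < C ^- (mabs ab.1 + mabs ab.2)
        * ((mfact ab.1 * mfact ab.2)%:R `^ (- mu)) :> R.
  by move=> C0; rewrite mulr_gt0 ?invr_gt0 ?exprn_gt0 ?powR_gt0 ?ltr0n
       ?muln_gt0 ?mfact_gt0.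
split=> [|a f g].
  rewrite inE; split; first exact: smooth0.
  exists 1 => //; apply/weighted_supP => [ab|]; first exact: w0.
  by exists 0 => ab x; rewrite cderivs0 mulr0 normc0 mulr0.
rewrite !inE => -[sf [C C0 nf]] [sg [D D0 ng]].
split; first exact: smooth_lin.
have CM : C <= Num.max C D by rewrite le_max lexx.
have DM : D <= Num.max C D by rewrite le_max lexx orbT.
exists (Num.max C D); first exact: lt_le_trans CM.
apply: weighted_sup_lin nf ng => [ab|ab|ab|ab x].
- by apply: w0; exact: lt_le_trans CM.
- by apply: ler_wpM2r; [exact: powR_ge0|exact: exprVn_anti].
- by apply: ler_wpM2r; [exact: powR_ge0|exact: exprVn_anti].
- by rewrite (cderivs_lin _ _ _ sf sg) mulrDr (mulrCA _ a).
Qed.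

Lemma TGS_submod m n (sigma mu : R) : submod_closed (@TGS R m n sigma mu).
Proof.
have w0 C (abc : mindex n * mindex n * mindex m) : 0 < C ->
    0 < C ^- (mabs abc.1.1 + mabs abc.1.2 + mabs abc.2)
       * ((mfact abc.2)%:R `^ (- sigma))
       * ((mfact abc.1.1 * mfact abc.1.2)%:R `^ (- mu)) :> R.
  by move=> C0; rewrite !mulr_gt0 ?invr_gt0 ?exprn_gt0 ?powR_gt0 ?ltr0n
       ?muln_gt0 ?mfact_gt0.
split=> [|a f g].
  rewrite inE; split; [exact: smooth0|by []|].
  exists 1 => //; apply/weighted_supP => [ab|]; first exact: w0.
  by exists 0 => ab x; rewrite cderivs0 mulr0 normc0 mulr0.
rewrite !inE => -[sf pf [C C0 nf]] [sg pg [D D0 ng]].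
split; first exact: smooth_lin.
  by move=> i z; rewrite !fctE pf pg.
have CM : C <= Num.max C D by rewrite le_max lexx.
have DM : D <= Num.max C D by rewrite le_max lexx orbT.
exists (Num.max C D); first exact: lt_le_trans CM.
apply: weighted_sup_lin nf ng => [abc|abc|abc|abc x].
- by apply: w0; exact: lt_le_trans CM.
- apply: ler_wpM2r; first exact: powR_ge0.
  by apply: ler_wpM2r; [exact: powR_ge0|exact: exprVn_anti].
- apply: ler_wpM2r; first exact: powR_ge0.
  by apply: ler_wpM2r; [exact: powR_ge0|exact: exprVn_anti].
- by rewrite (cderivs_lin _ _ _ sf sg) mulrDr (mulrCA _ a).
Qed.

End Linear.

Section Instances.
Context {R : realType}.
Variables (m n : nat) (sigma mu : R).

HB.instance Definition _ :=
  GRing.isSubmodClosed.Build _ _ (@GS R n mu) (@GS_submod R n mu).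
HB.instance Definition _ := [isSub for @gs_val R n mu].
HB.instance Definition _ := [Choice of @gs R n mu by <:].
HB.instance Definition _ := [SubChoice_isSubLmodule of @gs R n mu by <:].

HB.instance Definition _ :=
  GRing.isSubmodClosed.Build _ _ (@TGS R m n sigma mu)
    (@TGS_submod R m n sigma mu).
HB.instance Definition _ := [isSub for @tgs_val R m n sigma mu].
HB.instance Definition _ := [Choice of @tgs R m n sigma mu by <:].
HB.instance Definition _ :=
  [SubChoice_isSubLmodule of @tgs R m n sigma mu by <:].

End Instances.

Section Duals.
Context {R : realType}.
Variables (m n : nat) (sigma mu : R).
Import ComplexField.Normc.

Definition absolutely_convex (V : lmodType R[i]) (A : set V) : Prop :=
  forall (f g : V) (a b : R[i]), A f -> A g -> normc a + normc b <= 1 ->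
    A (a *: f + b *: g).

(* Neighbourhoods of f in the locally convex inductive limit topology of the
   spaces {f | gs_norm mu C f < +oo}, C > 0. *)
Definition gs_nbhs (f : gs n mu) : set_system (gs n mu) :=
  [set U | exists A : set (gs n mu),
    [/\ absolutely_convex A,
        forall C : R, 0 < C -> exists2 d : R, 0 < d &
          forall g : gs n mu, (gs_norm mu C g < d%:E)%E -> A g &
        forall g, A g -> U (f + g)]].

Definition gs_dual (u : gs n mu -> R[i]^o) : Prop :=
  linear u /\ forall f, u @ gs_nbhs f --> u f.

Definition tgs_dual (v : tgs m n sigma mu -> R[i]^o) : Prop :=
  linear v /\
  forall (C : R) (F : nat -> tgs m n sigma mu) (f : tgs m n sigma mu), 0 < C ->
    (forall j, tgs_norm sigma mu C (F j) < +oo)%E ->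
    (tgs_norm sigma mu C f < +oo)%E ->
    tgs_norm sigma mu C (F j - f) @[j --> \oo] --> 0%E ->
    v \o F @ \oo --> v f.

(* The functions paired with u below do belong to the test space, so that the
   default value 0 only serves to make the pairing total. *)
Definition gs_pairing (u : gs n mu -> R[i]^o) (f : 'rV[R]_n -> R[i]^o) :
    R[i]^o :=
  u (insubd 0 f).

End Duals.

Section Fourier.
Context {R : realType}.

Fixpoint box_integral m : ('rV[R]_m -> R) -> R :=
  if m is m'.+1 then fun g : 'rV[R]_(1 + m') -> R =>
    \int[lebesgue_measure]_(s in `[0, 2 * pi])
      box_integral (fun t : 'rV[R]_m' => g (row_mx s%:M t))
  else fun g => g 0.

Definition torus_integral m (g : 'rV[R]_m -> R[i]) : R[i] :=
  (box_integral (fun t => complex.Re (g t)) +i* box_integral (fun t => complex.Im (g t)))%C.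

Definition zdot m (k : 'rV[int]_m) (t : 'rV[R]_m) : R :=
  \sum_i (k 0 i)%:~R * t 0 i.

Definition znorm m (k : 'rV[int]_m) : R :=
  Num.sqrt (\sum_i (k 0 i)%:~R ^+ 2).

Definition expi (y : R) : R[i] := (cos y +i* sin y)%C.

Definition fourier_coef m n (f : 'rV[R]_(m + n) -> R[i]^o) (k : 'rV[int]_m) :
    'rV[R]_n -> R[i]^o :=
  fun x => (((2 * pi) ^- m)%:C)%C *
    torus_integral (fun t => f (row_mx t x) * expi (- zdot k t)).

Definition has_sum (I : choiceType) (F : I -> R[i]^o) (S : R[i]^o) : Prop :=
  partial_sum F @ totally --> S.

End Fourier.

(* Main.v *)
Require Import Defs.
From mathcomp Require Import all_boot all_order all_algebra finmap.
From mathcomp Require Import all_classical all_reals all_analysis.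
From mathcomp Require Import complex summability.
From mathcomp Require Import ring lra.
Set Implicit Arguments.
Unset Strict Implicit.
Unset Printing Implicit Defensive.
Import Order.TTheory GRing.Theory Num.Theory numFieldNormedType.Exports.
Local Open Scope classical_set_scope.
Local Open Scope ring_scope.
Import ComplexField.Normc.

(** The point is that the Fourier coefficients of f decay in one and the
    same seminorm, faster than the functionals u k may grow. Write c_k for
    the function of x obtained by integrating f(t, x) exp(i k . t) over the
    torus (this is [torus_coef f k]), which is (2 pi) ^ m times the Fourier
    coefficient of f at - k.

    Decay. Integrating by parts r times in t_i turns |k_i| ^ r c_k into the
    integral of the r-th derivative of f in t_i, up to a unimodular constant
    ([torus_coef_iter_by_parts]). If the seminorm of f with parameter C is
    at most M, the seminorm of |k_i| ^ r c_k with the same parameter is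
    therefore bounded by a constant times M C ^ r r!^sigma, for all r. Such
    a family of bounds amounts to an exponential decay in |k_i| ^ (1 /
    sigma) ([factorial_bounds_decay]); averaging over i, the seminorm of c_k
    is at most a constant times M exp (- b S(k)), where S(k) is the sum over
    i of |k_i| ^ (1 / sigma) and b > 0 depends only on C, sigma and m
    ([gs_norm_torus_coef_le]). That x-derivatives may be taken under the
    integral sign comes from the uniformity of continuous functions over the
    compact cube ([compact_near_uniform], [is_derive_box_integral],
    [pderivs_box_integral]).

    Existence. Since |k| ^ (1 / sigma) <= S(k), the growth hypothesis with
    epsilon = b / 2 bounds |u k (c_k)| by a constant times M exp (- b S(k) /
    2), which is summable over the lattice ([sum_exp_lattice]). Hence the
    family u k (c_k) is absolutely summable with a bound K M, K depending
    only on C ([sum_pairing_coef_le]). Its sum is linear in f, and the bound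
    K M gives sequential continuity ([synthesis_dual]). This is the first
    series.

    The second series has the same terms because u k commutes with the
    integral over the torus ([torus_integral_pairing]). For this no
    vector-valued integration is needed: t |-> f(t, .) exp(i k . t) is
    Lipschitz for a single seminorm that controls u k, so Riemann sums
    converge both to c_k in that seminorm, with an error proportional to the
    mesh, and, once u k is applied, to the integral of the pairings
    ([torus_Riemann_sum], [functional_torus_integral]). As the seminorms
    involve only derivatives in x of derivatives in t, the Lipschitz bound
    for the x-derivatives of f uses the symmetry of second derivatives
    ([pderivC]).

    Uniqueness is that of the sum of a family, the terms being prescribed. *)

(** * Iterated integrals over the cube *)

Lemma mx_continuous (X T : topologicalType) p q (g : X -> 'M[T]_(p, q)) (x : X) :
  (forall i j, {for x, continuous (fun y => g y i j)}) ->
  {for x, continuous g}.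
Proof.
move=> cg A [P nP sPA]; rewrite /nbhs/=.
suff : \forall y \near x, forall ij : 'I_p * 'I_q, P ij.1 ij.2 (g y ij.1 ij.2).
  by apply: filterS => y Py; apply: sPA => i j; exact: (Py (i, j)).
by apply: filter_forall => -[i j]; exact: (cg i j _ (nP i j)).
Qed.

Lemma continuous_comp_at (X Y Z : topologicalType) (f : X -> Y) (g : Y -> Z)
    (x : X) :
  {for x, continuous f} -> {for f x, continuous g} ->
  {for x, continuous (fun y => g (f y))}.
Proof. exact: continuous_comp. Qed.

Lemma continuous_pair_at (X Y Z : topologicalType) (f : X -> Y) (g : X -> Z)
    (x : X) :
  {for x, continuous f} -> {for x, continuous g} ->
  {for x, continuous (fun y => (f y, g y))}.
Proof. by move=> cf cg; exact: cvg_pair cf cg. Qed.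

Lemma continuous_cst_at (X Y : topologicalType) (c : Y) (x : X) :
  {for x, continuous (fun=> c)}.
Proof. exact: cst_continuous. Qed.

Lemma continuous_id_at (X : topologicalType) (x : X) :
  {for x, continuous (fun y => y)}.
Proof. exact: cvg_id. Qed.

Lemma continuous_fst_at (X Y : topologicalType) (x : X * Y) :
  {for x, continuous fst}.
Proof. exact: cvg_fst. Qed.

Lemma continuous_snd_at (X Y : topologicalType) (x : X * Y) :
  {for x, continuous snd}.
Proof. exact: cvg_snd. Qed.

Section Tube.
Context {R : realType}.

(** Uniformity over a compact set of parameters. *)
Lemma compact_near_uniform (X Y : topologicalType) (K : set X)
    (g : Y -> X -> R) (y0 : Y) (e : R) :
  compact K -> continuous (fun p : Y * X => g p.1 p.2) -> 0 < e ->
  \forall y \near y0, forall t, K t -> `|g y t - g y0 t| < e.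
Proof.
move=> /compact_near_coveringP cK cg e0.
pose P y t := `|g y t - g y0 t| < e.
apply: (cK Y (nbhs y0) P) => t Kt.
have e20 : 0 < e / 2 by rewrite divr_gt0.
have /= := @cvgr_dist_lt _ _ _ _ _ _ _ (cg (y0, t)) _ e20.
move=> [[U V] /= [nU nV] UV].
exists (V, U) => //= -[t' y] /= [Vt Uy].
rewrite /P -(subrKA (g y0 t)) (le_lt_trans (ler_normD _ _))//.
rewrite [ltRHS](splitr e) ltrD//; last first.
  by apply: (UV (y0, t')); split => //=; exact: nbhs_singleton.
by rewrite distrC; apply: (UV (y, t')).
Qed.

End Tube.

Section BoxIntegral.
Context {R : realType}.
Local Notation I01 := (`[0%R, 2 * pi : R]%classic).
Local Notation leb := (@lebesgue_measure R).

Lemma pi2_gt0 : 0 < 2 * pi :> R.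
Proof. by rewrite mulr_gt0// pi_gt0. Qed.

(** The cube [0, 2 pi] ^ m. *)
Definition cube m : set 'rV[R]_m :=
  [set t | forall i, I01 (t ord0 i)].

Lemma compact_cube m : compact (@cube m).
Proof. by apply: (@rV_compact _ m (fun=> I01)) => i; exact: segment_compact. Qed.

Lemma continuous_integrable (g : R -> R) (a b : R) : continuous g ->
  leb.-integrable `[a, b] (EFin \o g).
Proof.
move=> cg; apply: continuous_compact_integrable; first exact: segment_compact.
exact: continuous_subspaceT.
Qed.

Lemma Rintegral_normr_le (g : R -> R) (M : R) : continuous g ->
  (forall s, I01 s -> `|g s| <= M) ->
  `|\int[leb]_(s in I01) g s| <= 2 * pi * M.
Proof.
move=> cg gM.
have ig := continuous_integrable 0 (2 * pi) cg.
have := @le_normr_Rintegral _ _ _ leb I01 g (measurable_itv _) ig.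
move=> /le_trans; apply.
apply: (@le_trans _ _ (\int[leb]_(s in I01) cst M s)).
  apply: le_Rintegral => //.
  - apply: (continuous_integrable (g := fun s => `|g s|) 0 (2 * pi)) => s.
    exact: (cvg_norm (cg s)).
  - exact: (continuous_integrable (g := cst M) 0 (2 * pi) (@cst_continuous _ _ M)).
have := @Rintegral_cst _ _ _ leb I01 (measurable_itv _) M.
rewrite /cst => ->.
have e : fine (leb I01) = 2 * pi.
  by rewrite lebesgue_measure_itv/= lte_fin pi2_gt0 oppr0 adde0.
by rewrite [fine _](_ : _ = 2 * pi)// mulrC.
Qed.

Lemma continuous_Rintegral (Y : topologicalType) (g : Y -> R -> R) :
  continuous (fun p : Y * R => g p.1 p.2) ->
  continuous (fun y => \int[leb]_(s in I01) g y s).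
Proof.
move=> cg y0.
have cgy y : continuous (g y).
  move=> s; apply: (@continuous_comp_at _ _ _ (fun s => (y, s))
    (fun p : Y * R => g p.1 p.2)); last exact: cg.
  apply: continuous_pair_at; [exact: continuous_cst_at|exact: continuous_id_at].
apply/cvgrPdist_lt => e e0; pose d := e / (2 * pi) / 2.
have d0 : 0 < d by rewrite !divr_gt0// pi2_gt0.
have := compact_near_uniform y0 (@segment_compact _ 0 (2 * pi)) cg d0.
apply: filterS => y gy.
rewrite -RintegralB//; try exact: continuous_integrable.
apply: (@le_lt_trans _ _ (2 * pi * d)).
  apply: (Rintegral_normr_le (g := fun s => g y0 s - g y s)) => [s|s Ks].
    exact: (continuousB (cgy y0 s) (cgy y s)).
  by rewrite distrC ltW// gy.
rewrite /d mulrA [2 * pi * _]mulrC divfK ?gt_eqF ?pi2_gt0//.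
by rewrite ltr_pdivrMr// ltr_pMr// ltr1n.
Qed.

Lemma continuous_row_mx (X : topologicalType) p q (f : X -> 'rV[R]_p)
    (g : X -> 'rV[R]_q) (x : X) :
  {for x, continuous f} -> {for x, continuous g} ->
  {for x, continuous (fun y => row_mx (f y) (g y))}.
Proof.
move=> cf cg; apply: mx_continuous => i j.
case: (split_ordP j) => k ->.
- have -> : (fun y => row_mx (f y) (g y) i (lshift q k)) = (fun y => f y i k).
    by apply/funext => y; rewrite row_mxEl.
  apply: (@continuous_comp_at _ _ _ f (fun M : 'rV[R]_p => M i k) x) => //.
  exact: coord_continuous.
- have -> : (fun y => row_mx (f y) (g y) i (rshift p k)) = (fun y => g y i k).
    by apply/funext => y; rewrite row_mxEr.
  apply: (@continuous_comp_at _ _ _ g (fun M : 'rV[R]_q => M i k) x) => //.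
  exact: coord_continuous.
Qed.

Lemma continuous_scalar_mx1 : continuous (fun s : R => s%:M : 'rV[R]_1).
Proof.
move=> s; apply: mx_continuous => i j.
have -> : (fun y : R => (y%:M : 'rV[R]_1) i j) = id.
  by apply/funext => y; rewrite !ord1 mxE eqxx mulr1n.
exact: cvg_id.
Qed.

Lemma continuous_box_integral m (Y : topologicalType)
    (g : Y -> 'rV[R]_m -> R) :
  continuous (fun p : Y * 'rV[R]_m => g p.1 p.2) ->
  continuous (fun y => box_integral (g y)).
Proof.
elim: m Y g => [|m IH] Y g cg /=.
  move=> y; apply: (@continuous_comp_at Y (Y * 'rV[R]_0)%type R (fun y => (y, 0))
    (fun p => g p.1 p.2)); last exact: cg.
  apply: continuous_pair_at; [exact: continuous_id_at|exact: continuous_cst_at].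
apply: (continuous_Rintegral (g := fun y s => box_integral
  (fun t : 'rV[R]_m => g y (row_mx (s%:M : 'rV[R]_1) t)))).
apply: (IH (Y * R)%type
  (fun p t => g p.1 (row_mx (p.2%:M : 'rV[R]_1) t))) => -[[y s] t] /=.
apply: (@continuous_comp_at _ _ _ (fun p : Y * R * 'rV[R]_m =>
    (p.1.1, row_mx (p.1.2%:M : 'rV[R]_1) p.2 : 'rV[R]_(1 + m)))
  (fun p : Y * 'rV[R]_(1 + m) => g p.1 p.2)); last exact: cg.
apply: continuous_pair_at.
  apply: (@continuous_comp_at _ _ _ fst fst); exact: continuous_fst_at.
apply: continuous_row_mx; last exact: continuous_snd_at.
apply: (@continuous_comp_at _ _ _ (fun p : Y * R * 'rV[R]_m => p.1.2)
  (fun s : R => s%:M : 'rV[R]_1)); last exact: continuous_scalar_mx1.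
apply: (@continuous_comp_at _ _ _ fst snd);
  [exact: continuous_fst_at|exact: continuous_snd_at].
Qed.

(** The inner integrals of [box_integral] depend continuously on the first
    variable. *)
Lemma continuous_box_row m (g : 'rV[R]_m.+1 -> R) : continuous g ->
  continuous (fun s : R => box_integral
    (fun t : 'rV[R]_m => g (row_mx (s%:M : 'rV[R]_1) t))).
Proof.
move=> cg; apply: (continuous_box_integral
  (g := fun (s : R) t => g (row_mx (s%:M : 'rV[R]_1) t))) => -[s t] /=.
apply: (@continuous_comp_at _ _ _
  (fun p : R * 'rV[R]_m => (row_mx (p.1%:M : 'rV[R]_1) p.2 : 'rV[R]_(1 + m)))
  g); last exact: cg.
apply: continuous_row_mx; last exact: continuous_snd_at.
apply: (@continuous_comp_at _ _ _ (fun p : R * 'rV[R]_m => p.1)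
  (fun s : R => s%:M : 'rV[R]_1)); last exact: continuous_scalar_mx1.
exact: continuous_fst_at.
Qed.

Lemma continuous_row_slice m (g : 'rV[R]_m.+1 -> R) (s : R) : continuous g ->
  continuous (fun t : 'rV[R]_m => g (row_mx (s%:M : 'rV[R]_1) t)).
Proof.
move=> cg t; apply: (@continuous_comp_at _ _ _
  (fun t : 'rV[R]_m => (row_mx (s%:M : 'rV[R]_1) t : 'rV[R]_(1 + m)))
  g); last exact: cg.
apply: continuous_row_mx; [exact: continuous_cst_at|exact: continuous_id_at].
Qed.

Lemma box_integral_lin m (a : R) (f g : 'rV[R]_m -> R) :
  continuous f -> continuous g ->
  box_integral (fun t => a * f t + g t) = a * box_integral f + box_integral g.
Proof.
elim: m f g => [//|m IH] f g cf cg /=.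
under eq_Rintegral => s _.
  rewrite (IH (fun t => f (row_mx (s%:M : 'rV[R]_1) t))
    (fun t => g (row_mx (s%:M : 'rV[R]_1) t))); first last.
  - exact: continuous_row_slice.
  - exact: continuous_row_slice.
  over.
rewrite RintegralD//; try exact: continuous_integrable (continuous_box_row _).
  rewrite RintegralZl//.
  exact: continuous_integrable (continuous_box_row _).
apply: (continuous_integrable (g := fun s => a * box_integral
  (fun t : 'rV[R]_m => f (row_mx (s%:M : 'rV[R]_1) t)))) => s.
by apply: continuousM; [exact: cvg_cst|exact: continuous_box_row].
Qed.

Lemma cube_row m (s : R) (t : 'rV[R]_m) : I01 s -> cube t ->
  cube (row_mx (s%:M : 'rV[R]_1) t : 'rV[R]_m.+1).
Proof.
move=> Is ct i; rewrite -[m.+1]/(1 + m)%N in i *.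
case: (split_ordP i) => k ->.
  by rewrite row_mxEl !ord1 mxE eqxx mulr1n.
by rewrite row_mxEr.
Qed.

(** The cube has volume (2 pi) ^ m; the bound is only needed on the cube. *)
Lemma box_integral_normr_le m (g : 'rV[R]_m -> R) (M : R) : continuous g ->
  (forall t, cube t -> `|g t| <= M) ->
  `|box_integral g| <= (2 * pi) ^+ m * M.
Proof.
elim: m g => [|m IH] g cg gM /=.
  by rewrite expr0 mul1r; apply: gM => -[].
rewrite exprS -mulrA; apply: Rintegral_normr_le.
  exact: continuous_box_row.
move=> s Is; apply: IH; first exact: continuous_row_slice.
by move=> t ct; apply: gM; exact: cube_row.
Qed.

Lemma box_integralZ m (a : R) (f : 'rV[R]_m -> R) : continuous f ->
  box_integral (fun t => a * f t) = a * box_integral f.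
Proof.
move=> cf.
have z0 : box_integral (fun _ : 'rV[R]_m => 0 : R) = 0.
  apply/eqP; rewrite -normr_le0 -[leRHS](mulr0 ((2 * pi) ^+ m)).
  by apply: box_integral_normr_le => [|t _]; [exact: cst_continuous|rewrite normr0].
have := @box_integral_lin m a f (fun=> 0) cf (@cst_continuous _ _ _).
rewrite z0 addr0 => <-; congr box_integral; apply/funext => t.
by rewrite addr0.
Qed.

Lemma box_integralB m (f g : 'rV[R]_m -> R) : continuous f -> continuous g ->
  box_integral (fun t => f t - g t) = box_integral f - box_integral g.
Proof.
move=> cf cg; have := @box_integral_lin m (-1) g f cg cf.
rewrite mulN1r addrC => <-; congr box_integral; apply/funext => t.
by rewrite mulN1r addrC.
Qed.

End BoxIntegral.

(** * Differentiation under the integral, periods and Riemann sums *)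

Section Calculus.
Context {R : realType}.
Local Notation I01 := (`[0%R, 2 * pi : R]%classic).
Local Notation leb := (@lebesgue_measure R).

Lemma is_derive_cvg (V W : normedModType R) (f : V -> W) (x v : V) (l : W) :
  h^-1 *: (f (h *: v + x) - f x) @[h --> (0 : R)^'] --> l ->
  is_derive x v f l.
Proof.
move=> fl; split; first by apply/cvg_ex; exists l.
by apply/cvg_lim; [exact: norm_hausdorff|exact: fl].
Qed.

Lemma is_derive_cvgE (V W : normedModType R) (f : V -> W) (x v : V) (l : W) :
  is_derive x v f l ->
  h^-1 *: (f (h *: v + x) - f x) @[h --> (0 : R)^'] --> l.
Proof. by case=> d <-; exact: d. Qed.

Lemma is_derive_continuous (f : R -> R) (x l : R) :
  is_derive x 1 f l -> {for x, continuous f}.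
Proof. by case=> /derivable1_diffP /differentiable_continuous. Qed.

(** The mean value theorem for [a] and [b] in any order; the intermediate point
    is only located by its distance to [a]. *)
Lemma MVT_between (f df : R -> R) (a b : R) :
  (forall x : R, is_derive x 1 f (df x)) ->
  exists2 c, `|c - a| <= `|b - a| & f b - f a = df c * (b - a).
Proof.
move=> fd; have cf (x y : R) : {within `[x, y], continuous f}.
  by apply: continuous_subspaceT => z; exact: is_derive_continuous (fd z).
have [ab|ba] := leP a b.
- have [c + ->] := MVT_segment ab (fun x _ => fd x) (cf _ _).
  rewrite in_itv/= => /andP[ac cb]; exists c => //.
  by rewrite !ger0_norm ?subr_ge0// lerD2r.
- have [c + e] := MVT_segment (ltW ba) (fun x _ => fd x) (cf _ _).
  rewrite in_itv/= => /andP[bc ca]; exists c.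
    rewrite distrC (distrC b) !ger0_norm ?subr_ge0// ?(ltW ba)//.
    by rewrite lerD2l lerN2.
  by rewrite -opprB e -mulrN opprB.
Qed.

(** Differentiation under the integral: the difference quotients of phi tend to
    psi uniformly on the cube, by the mean value theorem and compactness. *)
Lemma is_derive_box_integral m (phi psi : R -> 'rV[R]_m -> R) (y : R) :
  (forall (y : R) t, is_derive y 1 (phi ^~ t) (psi y t)) ->
  (forall y, continuous (phi y)) ->
  continuous (fun p : R * 'rV[R]_m => psi p.1 p.2) ->
  is_derive y 1 (fun y => box_integral (phi y)) (box_integral (psi y)).
Proof.
move=> dphi cphi cpsi; apply: is_derive_cvg; apply/cvgrPdist_le => e e0.
have cpsiy : continuous (psi y).
  move=> t; apply: (@continuous_comp_at _ _ _ (fun t => (y, t))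
    (fun p : R * 'rV[R]_m => psi p.1 p.2)); last exact: cpsi.
  apply: continuous_pair_at; [exact: continuous_cst_at|exact: continuous_id_at].
pose d := e / (2 * pi) ^+ m; have p0 : 0 < (2 * pi) ^+ m :> R.
  by rewrite exprn_gt0// pi2_gt0.
have d0 : 0 < d by rewrite divr_gt0.
(* An error of [d] in the integrand gives an error of [e] in the integral. *)
have /nbhs_ballP[r /= r0 yr] :=
  compact_near_uniform y (@compact_cube R m) cpsi d0.
exists r => //= h hr h0.
have hr' : `|h| < r by move: hr; rewrite /= sub0r normrN.
rewrite /GRing.scale/= mulr1 -box_integralB//.
have cB : continuous (fun t => phi (h + y) t - phi y t).
  by move=> t; exact: (continuousB (cphi (h + y) t) (cphi y t)).
rewrite -box_integralZ//.
have cZ : continuous (fun t => h^-1 * (phi (h + y) t - phi y t)).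
  by move=> t; exact: (continuousM (@continuous_cst_at _ _ h^-1 t) (cB t)).
rewrite -box_integralB//.
have -> : e = (2 * pi) ^+ m * d by rewrite /d mulrC divfK// gt_eqF.
apply: box_integral_normr_le => [t|t ct].
  exact: (continuousB (cpsiy t) (cZ t)).
(* The difference quotient is psi at some point between [y] and [h + y]. *)
have [c cy ->] := MVT_between y (h + y) (fun x => dphi x t).
rewrite addrK mulrC mulfK// distrC; apply/ltW/yr => //.
rewrite /ball/= distrC (le_lt_trans cy)//.
by rewrite addrK.
Qed.

Lemma Rintegral_FTC (F f : R -> R) : continuous f ->
  (forall x : R, 0 <= x <= 2 * pi -> is_derive x 1 F (f x)) ->
  \int[leb]_(s in I01) f s = F (2 * pi) - F 0.
Proof.
move=> cf dF; rewrite /Rintegral (@continuous_FTC2 _ f F) ?pi2_gt0//.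
- exact: continuous_subspaceT.
- split.
  + move=> x; rewrite in_itv/= => /andP[x0 x1].
    by have [] := dF x; rewrite ?(ltW x0) ?(ltW x1).
  + apply: cvg_at_right_filter; apply: is_derive_continuous.
    by apply: dF; rewrite lexx ltW// pi2_gt0.
  + apply: cvg_at_left_filter; apply: is_derive_continuous.
    by apply: dF; rewrite lexx ltW// pi2_gt0.
- move=> x; rewrite in_itv/= => /andP[x0 x1].
  have dx : is_derive x 1 F (f x) by apply: dF; rewrite !ltW.
  by rewrite derive1E derive_val.
Qed.

(** A primitive that is differentiable at 0 as well, its integral being taken
    from -1. *)
Lemma Rintegral_primitive (f : R -> R) : continuous f ->
  exists2 F : R -> R, (forall x : R, 0 <= x -> is_derive x 1 F (f x)) &
    \int[leb]_(s in I01) f s = F (2 * pi) - F 0.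
Proof.
move=> cf; pose F (x : R) : R := \int[leb]_(s in `[-1, x]) f s.
have dF (x : R) : 0 <= x -> is_derive x 1 F (f x).
  move=> x0; have [] := @continuous_FTC1 _ f (BLeft (-1)) x (x + 1) _ _ _ (cf x).
  - by rewrite ltrDl.
  - exact: continuous_integrable.
  - by rewrite lte_fin (lt_le_trans _ x0)// ltrN10.
  - move=> d e; have := derivableP d; rewrite -derive1E e; exact: id.
exists F => //; apply: Rintegral_FTC => // x /andP[x0 _]; exact: dF.
Qed.

Lemma addr_row_delta m (s h : R) (t : 'rV[R]_m) :
  row_mx ((h + s)%:M : 'rV[R]_1) t =
  h *: delta_mx 0 (lshift m ord0) + row_mx (s%:M : 'rV[R]_1) t.
Proof.
apply/rowP => i; rewrite !mxE; case: (split_ordP i) => k ->.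
  by rewrite !ord1 !mxE !eqxx/= !mulr1n mulr1.
by rewrite eq_rlshift/= mulr0 add0r.
Qed.

Lemma row_addr_delta m (s h : R) (t : 'rV[R]_m) (k : 'I_m) :
  row_mx (s%:M : 'rV[R]_1) (h *: delta_mx 0 k + t) =
  h *: delta_mx 0 (rshift 1 k) + row_mx (s%:M : 'rV[R]_1) t.
Proof.
apply/rowP => i; rewrite !mxE; case: (split_ordP i) => j ->.
  by rewrite eq_lrshift/= mulr0 add0r.
by rewrite !mxE eq_rshift.
Qed.

(** The integral over a full period of a derivative vanishes. *)
Lemma box_integral_derive_periodic m (i : 'I_m) (g dg : 'rV[R]_m -> R) :
  continuous g -> continuous dg ->
  (forall t, is_derive t (delta_mx 0 i) g (dg t)) ->
  (forall t, g ((2 * pi) *: delta_mx 0 i + t) = g t) ->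
  box_integral dg = 0.
Proof.
elim: m i g dg => [[]//|m IH] i g dg cg cdg gd gp.
rewrite -[m.+1]/(1 + m)%N in i g dg cg cdg gd gp *.
case: (split_ordP i) gd gp => k -> gd gp /=; last first.
  rewrite [LHS](_ : _ = \int[leb]_(s in I01) cst 0 s).
    by rewrite Rintegral_cst// mul0r.
  apply: eq_Rintegral => s _; apply: (IH k
    (fun t : 'rV[R]_m => g (row_mx (s%:M : 'rV[R]_1) t))).
  - exact: continuous_row_slice.
  - exact: continuous_row_slice.
  - move=> t; apply: is_derive_cvg.
    under eq_fun do rewrite row_addr_delta.
    exact: is_derive_cvgE.
  - by move=> t; rewrite row_addr_delta gp.
(* Here the derivative is taken in the variable of the outermost integral. *)
rewrite !ord1 {k} in gd gp *.
pose B s := box_integral (fun t : 'rV[R]_m => g (row_mx (s%:M : 'rV[R]_1) t)).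
have dB (s : R) : is_derive s 1 B
    (box_integral (fun t : 'rV[R]_m => dg (row_mx (s%:M : 'rV[R]_1) t))).
  apply: (is_derive_box_integral
    (phi := fun s (t : 'rV[R]_m) => g (row_mx (s%:M : 'rV[R]_1) t))
    (psi := fun s (t : 'rV[R]_m) => dg (row_mx (s%:M : 'rV[R]_1) t))).
  - move=> {}s t; apply: is_derive_cvg.
    under eq_fun => h do rewrite [h *: 1]mulr1 addr_row_delta.
    exact: is_derive_cvgE.
  - by move=> y; exact: continuous_row_slice.
  - move=> -[y t] /=; apply: (@continuous_comp_at _ _ _
    (fun p : R * 'rV[R]_m => (row_mx (p.1%:M : 'rV[R]_1) p.2 : 'rV[R]_(1 + m)))
      dg); last exact: cdg.
    apply: continuous_row_mx; last exact: continuous_snd_at.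
    apply: (@continuous_comp_at _ _ _ (fun p : R * 'rV[R]_m => p.1)
      (fun s : R => s%:M : 'rV[R]_1)); last exact: continuous_scalar_mx1.
    exact: continuous_fst_at.
have := @Rintegral_FTC B _ (@continuous_box_row _ _ _ cdg) (fun s _ => dB s).
move=> ->; apply/eqP; rewrite subr_eq0; apply/eqP; congr box_integral.
by apply/funext => t; rewrite -[2 * pi]addr0 addr_row_delta gp.
Qed.

(** The sum of the values of a function at the nodes of the regular grid of
    [N ^ m] points of the cube of side 2 pi. *)
Fixpoint grid_sum (V : nmodType) (N m : nat) : ('rV[R]_m -> V) -> V :=
  if m is m'.+1 then fun q : 'rV[R]_(1 + m') -> V =>
    \sum_(j < N) grid_sum N (fun t : 'rV[R]_m' =>
      q (row_mx (2 * pi * j%:R / N%:R)%:M t))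
  else fun q => q 0.

(** Additive maps commute with grid sums; this applies to a functional on a space
    of functions as well as to the evaluation of a derivative. *)
Lemma grid_sum_morph (V W : nmodType) (f : V -> W) (N m : nat)
    (q : 'rV[R]_m -> V) :
  f 0 = 0 -> {morph f : x y / x + y} ->
  f (grid_sum N q) = grid_sum N (f \o q).
Proof.
move=> f0 fD; elim: m q => [//|m IH] q /=.
by rewrite (big_morph f fD f0); apply: eq_bigr => j _; rewrite IH.
Qed.

(** The rectangle rule: on each of the [N] intervals of length 2 pi / N the mean
    value theorem gives an error of at most L (2 pi / N) ^ 2. *)
Lemma Riemann_sum1 (q : R -> R) (L : R) (N : nat) : (0 < N)%N ->
  continuous q -> 0 <= L -> (forall s h, `|q (h + s) - q s| <= L * `|h|) ->
  `|\int[leb]_(s in I01) q s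
    - 2 * pi / N%:R * \sum_(j < N) q (2 * pi * j%:R / N%:R)|
  <= (2 * pi) ^+ 2 * L / N%:R.
Proof.
move=> N0 cq L0 qL; have [G dG ->] := Rintegral_primitive cq.
have N0' : 0 < N%:R :> R by rewrite ltr0n.
have pN : 0 < 2 * pi / N%:R :> R by rewrite divr_gt0// pi2_gt0.
pose x (j : nat) : R := 2 * pi * j%:R / N%:R.
(* The integral is the sum of the increments of a primitive over the mesh. *)
have -> : G (2 * pi) - G 0 = \sum_(j < N) (G (x j.+1) - G (x j)).
  rewrite -(big_mkord xpredT (fun j => G (x j.+1) - G (x j))) telescope_sumr//.
  by rewrite /x mulfK ?gt_eqF// mulr0 mul0r.
rewrite mulr_sumr -sumrB (le_trans (ler_norm_sum _ _ _))//.
have -> : (2 * pi) ^+ 2 * L / N%:R =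
    \sum_(j < N) 2 * pi / N%:R * (L * (2 * pi / N%:R)).
  rewrite sumr_const card_ord -mulr_natr expr2.
  by field; rewrite gt_eqF.
apply: ler_sum => j _.
have xS : x j.+1 = 2 * pi / N%:R + x j.
  by rewrite /x -natr1; field; rewrite gt_eqF.
have x0 : 0 <= x j by rewrite /x divr_ge0// mulr_ge0// ltW// pi2_gt0.
have xx : x j < x j.+1 by rewrite xS ltrDr.
have [||c] := @MVT _ G q (x j) (x j.+1) xx.
- by move=> y; rewrite in_itv/= => /andP[xy _]; apply: dG; exact: le_trans (ltW xy).
- apply: derivable_within_continuous => y; rewrite in_itv/= => /andP[xy _].
  by have [] := dG y (le_trans x0 xy).
rewrite in_itv/= => /andP[c1 c2] ->.
rewrite -/(x j) xS addrK mulrC -mulrBr normrM gtr0_norm// ler_pM2l//.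
rewrite -{1}[c](subrK (x j)) (le_trans (qL _ _))// ler_wpM2l//.
rewrite ger0_norm ?subr_ge0 ?(ltW c1)// lerBlDr.
by rewrite -xS ltW.
Qed.

(** The rectangle rule in m variables, by induction: an error occurs in the first
    variable, where the inner integral is Lipschitz with constant
    (2 pi) ^ (m - 1) L, and in the inner integrals. *)
Lemma Riemann_sum m (q : 'rV[R]_m -> R) (L : R) (N : nat) : (0 < N)%N ->
  continuous q -> 0 <= L ->
  (forall i h t, `|q (h *: delta_mx 0 i + t) - q t| <= L * `|h|) ->
  `|box_integral q - (2 * pi / N%:R) ^+ m * grid_sum N q|
  <= m%:R * (2 * pi) ^+ m.+1 * L / N%:R.
Proof.
move=> N0 + L0; have N0' : 0 < N%:R :> R by rewrite ltr0n.
have pN : 0 < 2 * pi / N%:R :> R by rewrite divr_gt0// pi2_gt0.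
elim: m q => [|m IH] q cq qL.
  by rewrite /= expr0 mul1r subrr normr0 !mul0r.
pose B s := box_integral (fun t : 'rV[R]_m => q (row_mx (s%:M : 'rV[R]_1) t)).
pose S s := grid_sum N (fun t : 'rV[R]_m => q (row_mx (s%:M : 'rV[R]_1) t)).
pose x (j : nat) : R := 2 * pi * j%:R / N%:R.
have BS s : `|B s - (2 * pi / N%:R) ^+ m * S s| <=
    m%:R * (2 * pi) ^+ m.+1 * L / N%:R.
  apply: IH; first exact: continuous_row_slice.
  by move=> i h t; rewrite row_addr_delta.
have BL s h : `|B (h + s) - B s| <= (2 * pi) ^+ m * L * `|h|.
  rewrite /B -box_integralB; [|exact: continuous_row_slice..].
  rewrite -mulrA; apply: box_integral_normr_le => [t|t _].
    exact: (continuousB (@continuous_row_slice _ _ _ (h + s) cq t)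
      (@continuous_row_slice _ _ _ s cq t)).
  by rewrite addr_row_delta.
rewrite [box_integral q]/= [grid_sum _ _]/= -/(B _).
rewrite (_ : (2 * pi / N%:R) ^+ m.+1 * _ = 2 * pi / N%:R *
    \sum_(j < N) (2 * pi / N%:R) ^+ m * S (x j)); last first.
  by rewrite exprS -mulrA mulr_sumr.
rewrite -(subrKA (2 * pi / N%:R * \sum_(j < N) B (x j))).
rewrite (le_trans (ler_normD _ _))//.
have -> : m.+1%:R * (2 * pi) ^+ m.+2 * L / N%:R =
  (2 * pi) ^+ 2 * ((2 * pi) ^+ m * L) / N%:R +
  2 * pi / N%:R * \sum_(j < N) (m%:R * (2 * pi) ^+ m.+1 * L / N%:R).
  rewrite sumr_const card_ord -(mulr_natr _ N) -natr1 !exprS.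
  by field; rewrite gt_eqF.
apply: lerD.
  apply: Riemann_sum1 => //; first exact: continuous_box_row.
  by rewrite mulr_ge0// exprn_ge0// ltW// pi2_gt0.
rewrite -mulrBr normrM gtr0_norm// ler_pM2l// -sumrB.
by apply: le_trans (ler_norm_sum _ _ _) _; apply: ler_sum => j _.
Qed.

End Calculus.

(** * Partial derivatives and smooth families *)

Section PartialDerivatives.
Context {R : realType}.

Lemma pderivs_cat d (s1 s2 : seq 'I_d) (g : 'rV[R]_d -> R) :
  pderivs (s1 ++ s2) g = pderivs s1 (pderivs s2 g).
Proof. exact: foldr_cat. Qed.

Lemma rsmooth_pderivs d (s : seq 'I_d) (g : 'rV[R]_d -> R) :
  rsmooth g -> rsmooth (pderivs s g).
Proof. by move=> sg s'; rewrite -pderivs_cat; exact: sg. Qed.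

Lemma rsmooth_is_derive d (i : 'I_d) (g : 'rV[R]_d -> R) (x : 'rV[R]_d) :
  rsmooth g -> is_derive x (delta_mx 0 i) g (pderiv i g x).
Proof. by move=> sg; apply: derivableP; exact: (sg [::]).2. Qed.

Lemma is_derive_line d (g dg : 'rV[R]_d -> R) (v x : 'rV[R]_d) (h : R) :
  (forall y, is_derive y v g (dg y)) ->
  is_derive h 1 (fun h : R => g (h *: v + x)) (dg (h *: v + x)).
Proof.
move=> gd; apply: is_derive_cvg.
have -> : (fun k : R => k^-1 *: (g ((k *: 1 + h) *: v + x) - g (h *: v + x))) =
    (fun k => k^-1 *: (g (k *: v + (h *: v + x)) - g (h *: v + x))).
  by apply/funext => k; rewrite [k *: 1]mulr1 scalerDl addrA.
exact: is_derive_cvgE.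
Qed.

(** The weight [c] is kept outside the difference because it may vanish; the
    derivative is only bounded along a line. *)
Lemma lipschitz_pderiv d (i : 'I_d) (g : 'rV[R]_d -> R) (c M h : R)
    (x : 'rV[R]_d) :
  rsmooth g -> 0 <= c ->
  (forall a, c * `|pderiv i g (a *: delta_mx 0 i + x)| <= M) ->
  c * `|g (h *: delta_mx 0 i + x) - g x| <= M * `|h|.
Proof.
move=> sg c0 gM.
have [a _] := MVT_between 0 h
  (fun a => is_derive_line x a (fun y => rsmooth_is_derive i y sg)).
rewrite scale0r add0r subr0 => ->.
by rewrite normrM mulrA ler_wpM2r.
Qed.

(** The second difference quotient of g is a value of its mixed derivative, by
    two applications of the mean value theorem. *)
Lemma second_difference d (i j : 'I_d) (g : 'rV[R]_d -> R) (x : 'rV[R]_d)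
    (h : R) : rsmooth g ->
  exists a b : R, [/\ `|a| <= `|h|, `|b| <= `|h| &
    (g (h *: delta_mx 0 i + (h *: delta_mx 0 j + x)) - g (h *: delta_mx 0 j + x))
    - (g (h *: delta_mx 0 i + x) - g x) =
    pderiv i (pderiv j g) (a *: delta_mx 0 i + (b *: delta_mx 0 j + x))
    * h ^+ 2].
Proof.
move=> sg; pose dg := pderiv j g.
have sdg : rsmooth dg := rsmooth_pderivs [:: j] sg.
pose P (b : R) := g (b *: delta_mx 0 j + (h *: delta_mx 0 i + x)) -
  g (b *: delta_mx 0 j + x).
have dP (b : R) : is_derive b 1 P
    (dg (b *: delta_mx 0 j + (h *: delta_mx 0 i + x)) -
     dg (b *: delta_mx 0 j + x)).
  have gj y := rsmooth_is_derive j y sg.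
  exact: is_deriveB (is_derive_line _ b gj) (is_derive_line _ b gj).
have [b] := MVT_between 0 h dP; rewrite !subr0 => bh.
rewrite /P !scale0r !add0r addrCA => ->.
have [a ah] := MVT_between 0 h (fun c => is_derive_line
  (b *: delta_mx 0 j + x) c (fun y => rsmooth_is_derive i y sdg)).
rewrite !subr0 in ah *; rewrite scale0r add0r addrCA => ->.
by exists a, b; split=> //; rewrite expr2 mulrA.
Qed.

Lemma continuous_plane d (v w x : 'rV[R]_d) :
  continuous (fun p : R * R => p.1 *: v + (p.2 *: w + x)).
Proof.
move=> p.
have c1 : {for p, continuous (fun p : R * R => p.1 *: v)}.
  apply: (@continuous_comp_at _ _ _ fst (fun a : R => a *: v)).
    exact: continuous_fst_at.
  exact: scalel_continuous.
have c2 : {for p, continuous (fun p : R * R => p.2 *: w)}.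
  apply: (@continuous_comp_at _ _ _ snd (fun a : R => a *: w)).
    exact: continuous_snd_at.
  exact: scalel_continuous.
exact: (continuousD c1 (continuousD c2 (@continuous_cst_at _ _ x p))).
Qed.

(** Symmetry of the second derivatives. *)
Lemma pderivC d (i j : 'I_d) (g : 'rV[R]_d -> R) : rsmooth g ->
  pderiv i (pderiv j g) = pderiv j (pderiv i g).
Proof.
move=> sg; apply/funext => x.
set A := pderiv i (pderiv j g); set B := pderiv j (pderiv i g).
have cA : continuous A by exact: (sg [:: i; j]).1.
have cB : continuous B by exact: (sg [:: j; i]).1.
have sA h := second_difference i j x h sg.
have sB h := second_difference j i x h sg.
rewrite -/A in sA; rewrite -/B in sB; clearbody A B.
have near_line (G : 'rV[R]_d -> R) (v w : 'rV[R]_d) (e : R) : continuous G ->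
    0 < e -> exists2 r : R, 0 < r & forall a b, `|a| < r -> `|b| < r ->
      `|G x - G (a *: v + (b *: w + x))| < e.
  move=> cG e0; pose G2 (p : R * R) := G (p.1 *: v + (p.2 *: w + x)).
  have cG2 : {for (0, 0), continuous G2}.
    apply: (@continuous_comp_at _ _ _
      (fun p : R * R => p.1 *: v + (p.2 *: w + x)) G).
      exact: continuous_plane.
    exact: cG.
  have /(@cvgrPdist_lt _ _ _ _ _ _) /(_ e e0) := cG2.
  rewrite /G2/= !scale0r !add0r => /nbhs_ballP[r /= r0 rG].
  exists r => // a b ar br; apply: (rG (a, b)); split => /=.
    by rewrite /ball/= sub0r normrN.
  by rewrite /ball/= sub0r normrN.
apply/eqP; rewrite -subr_eq0 -normr_le0; apply/ler_addgt0Pr => e e0.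
rewrite add0r.
have e20 : 0 < e / 2 by rewrite divr_gt0.
have [r1 r10 A1] := near_line A (delta_mx 0 i) (delta_mx 0 j) _ cA e20.
have [r2 r20 B1] := near_line B (delta_mx 0 j) (delta_mx 0 i) _ cB e20.
(* Both mixed derivatives take the value of the same second difference, at
   points within [h] of [x] in each of the directions [i] and [j]. *)
pose h := Num.min r1 r2 / 2.
have h0 : 0 < h by rewrite divr_gt0// lt_min r10.
have hr : h < Num.min r1 r2.
  by rewrite /h ltr_pdivrMr// ltr_pMr ?ltr1n// lt_min r10.
have [a [b [ah bh Aab]]] := sA h.
have [a' [b' [ah' bh' Bab]]] := sB h.
rewrite (gtr0_norm h0) in ah bh ah' bh'.
have hr1 : h < r1 by rewrite (lt_le_trans hr)// ge_min lexx.
have hr2 : h < r2 by rewrite (lt_le_trans hr)// ge_min lexx orbT.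
have AB : A (a *: delta_mx 0 i + (b *: delta_mx 0 j + x)) =
    B (a' *: delta_mx 0 j + (b' *: delta_mx 0 i + x)).
  apply: (@mulIf _ (h ^+ 2)); first by rewrite expf_neq0// gt_eqF.
  have swap (p q r t : R) : p - q - (r - t) = p - r - (q - t) by ring.
  rewrite (addrCA (h *: delta_mx 0 j) (h *: delta_mx 0 i) x) swap in Bab.
  exact: etrans (esym Aab) Bab.
rewrite -(subrKA (A (a *: delta_mx 0 i + (b *: delta_mx 0 j + x)))).
rewrite (le_trans (ler_normD _ _))// (splitr e) lerD//.
  by apply: ltW; apply: A1; exact: le_lt_trans hr1.
by rewrite AB distrC; apply: ltW; apply: B1; exact: le_lt_trans hr2.
Qed.

Lemma pderivs_pderivC d (s : seq 'I_d) (i : 'I_d) (g : 'rV[R]_d -> R) :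
  rsmooth g -> pderivs s (pderiv i g) = pderiv i (pderivs s g).
Proof.
move=> sg; elim: s => //= j s ->.
exact: (pderivC j i (rsmooth_pderivs s sg)).
Qed.

(** A period of g is a period of its derivatives. *)
Lemma pderivs_periodic d (s : seq 'I_d) (g : 'rV[R]_d -> R) (p : 'rV[R]_d) :
  (forall z, g (z + p) = g z) -> forall z, pderivs s g (z + p) = pderivs s g z.
Proof.
move=> gp; elim: s => //= i s IH z.
rewrite /pderiv /derive.
set q1 := (X in lim (X @ _)); set q2 := (X in _ = lim (X @ _)).
suff -> : q1 = q2 by [].
by apply/funext => h; rewrite /q1 /q2/= addrA !IH.
Qed.

End PartialDerivatives.

Section Families.
Context {R : realType}.

(** Families of smooth functions of x, depending on t, all of whose
    x-derivatives are jointly continuous in (t, x). *)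
Definition smooth_family m n (Phi : 'rV[R]_m -> 'rV[R]_n -> R) : Prop :=
  forall s : seq 'I_n,
    continuous (fun p : 'rV[R]_m * 'rV[R]_n => pderivs s (Phi p.1) p.2) /\
    forall t i x, derivable (pderivs s (Phi t)) x (delta_mx 0 i).

Lemma smooth_family_rsmooth m n (Phi : 'rV[R]_m -> 'rV[R]_n -> R) t :
  smooth_family Phi -> rsmooth (Phi t).
Proof.
move=> sP s; split; last exact: (sP s).2.
move=> x; apply: (@continuous_comp_at _ _ _ (fun x => (t, x))
  (fun p : 'rV[R]_m * 'rV[R]_n => pderivs s (Phi p.1) p.2)).
  apply: continuous_pair_at; [exact: continuous_cst_at|exact: continuous_id_at].
exact: (sP s).1.
Qed.

Lemma smooth_family_continuous m n (Phi : 'rV[R]_m -> 'rV[R]_n -> R) s x :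
  smooth_family Phi -> continuous (fun t => pderivs s (Phi t) x).
Proof.
move=> sP t; apply: (@continuous_comp_at _ _ _ (fun t => (t, x))
  (fun p : 'rV[R]_m * 'rV[R]_n => pderivs s (Phi p.1) p.2)).
  apply: continuous_pair_at; [exact: continuous_id_at|exact: continuous_cst_at].
exact: (sP s).1.
Qed.

(** Integration over the parameter preserves smoothness and commutes with the
    derivatives. *)
Lemma pderivs_box_integral m n (Phi : 'rV[R]_m -> 'rV[R]_n -> R) :
  smooth_family Phi ->
  rsmooth (fun x => box_integral (fun t => Phi t x)) /\
  forall s x, pderivs s (fun x => box_integral (fun t => Phi t x)) x =
    box_integral (fun t => pderivs s (Phi t) x).
Proof.
move=> sP; set G := fun x => _.
have key s i x : is_derive x (delta_mx 0 i)
    (fun x => box_integral (fun t => pderivs s (Phi t) x))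
    (box_integral (fun t => pderivs (i :: s) (Phi t) x)).
  pose phi (y : R) t := pderivs s (Phi t) (y *: delta_mx 0 i + x).
  pose psi (y : R) t := pderivs (i :: s) (Phi t) (y *: delta_mx 0 i + x).
  have dphi (y : R) t : is_derive y 1 (phi ^~ t) (psi y t).
    apply: is_derive_line => z.
    exact: rsmooth_is_derive (rsmooth_pderivs _ (smooth_family_rsmooth t sP)).
  have cphi y : continuous (phi y) by exact: smooth_family_continuous.
  have cpsi : continuous (fun p : R * 'rV[R]_m => psi p.1 p.2).
    move=> p; apply: (@continuous_comp_at _ _ _
      (fun p : R * 'rV[R]_m => (p.2, p.1 *: delta_mx 0 i + x))
      (fun p : 'rV[R]_m * 'rV[R]_n => pderivs (i :: s) (Phi p.1) p.2));
      last exact: (sP (i :: s)).1.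
    apply: continuous_pair_at; first exact: continuous_snd_at.
    have c1 : {for p, continuous
        (fun p : R * 'rV[R]_m => p.1 *: delta_mx 0 i : 'rV[R]_n)}.
      apply: (@continuous_comp_at _ _ _ fst (fun a : R => a *: delta_mx 0 i)).
        exact: continuous_fst_at.
      exact: scalel_continuous.
    exact: (continuousD c1 (@continuous_cst_at _ _ x p)).
  have /is_derive_cvgE := is_derive_box_integral 0 dphi cphi cpsi.
  rewrite /phi /psi scale0r add0r => c; apply: is_derive_cvg.
  apply: cvg_trans c; apply: near_eq_cvg; near=> h.
  by rewrite [h *: 1]mulr1 addr0.
have E s : pderivs s G = fun x => box_integral (fun t => pderivs s (Phi t) x).
  elim: s => //= i s ->; apply/funext => x.
  by have d := key s i x; rewrite /pderiv derive_val.
split=> [s|s x]; rewrite E//; split=> [|i x]; last by have [] := key s i x.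
apply: (continuous_box_integral
  (g := fun x t => pderivs s (Phi t) x)) => -[x t] /=.
apply: (@continuous_comp_at _ _ _ (fun p : 'rV[R]_n * 'rV[R]_m => (p.2, p.1))
  (fun p : 'rV[R]_m * 'rV[R]_n => pderivs s (Phi p.1) p.2)).
  apply: continuous_pair_at; [exact: continuous_snd_at|exact: continuous_fst_at].
exact: (sP s).1.
Unshelve. all: end_near. Qed.

Lemma smooth_family_lin m n (a : 'rV[R]_m -> R)
    (Phi Psi : 'rV[R]_m -> 'rV[R]_n -> R) : continuous a ->
  smooth_family Phi -> smooth_family Psi ->
  smooth_family (fun t x => a t * Phi t x + Psi t x).
Proof.
move=> ca sP sQ s.
have E t : pderivs s (fun x => a t * Phi t x + Psi t x) =
    (fun x => a t * pderivs s (Phi t) x + pderivs s (Psi t) x).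
  by apply: pderivs_lin; exact: smooth_family_rsmooth.
split=> [|t i x].
  under [X in continuous X]funext => p do rewrite E.
  move=> p; have ca1 : {for p, continuous (fun p : 'rV[R]_m * 'rV[R]_n => a p.1)}.
    apply: (@continuous_comp_at _ _ _ fst a); last exact: ca.
    exact: continuous_fst_at.
  exact: (continuousD (continuousM ca1 ((sP s).1 p)) ((sQ s).1 p)).
exact: (rsmooth_lin (a t) (smooth_family_rsmooth t sP)
  (smooth_family_rsmooth t sQ) s).2.
Qed.

Lemma row_mx_addr_delta m n (t : 'rV[R]_m) (x : 'rV[R]_n) (h : R) i :
  row_mx t (h *: delta_mx 0 i + x) = h *: delta_mx 0 (rshift m i) + row_mx t x.
Proof.
apply/rowP => k; rewrite !mxE; case: (split_ordP k) => j ->.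
  by rewrite eq_lrshift/= mulr0 add0r.
by rewrite !mxE eq_rshift.
Qed.

Lemma row_mx_addl_delta m n (t : 'rV[R]_m) (x : 'rV[R]_n) (h : R) i :
  row_mx (h *: delta_mx 0 i + t) x = h *: delta_mx 0 (lshift n i) + row_mx t x.
Proof.
apply/rowP => k; rewrite !mxE; case: (split_ordP k) => j ->.
  by rewrite !mxE eq_lshift.
by rewrite eq_rlshift/= mulr0 add0r.
Qed.

Lemma is_derive_row_mxr m n (g : 'rV[R]_(m + n) -> R) t x i l :
  is_derive (row_mx t x) (delta_mx 0 (rshift m i)) g l ->
  is_derive x (delta_mx 0 i) (fun x : 'rV[R]_n => g (row_mx t x)) l.
Proof.
move=> gd; apply: is_derive_cvg.
under eq_fun do rewrite row_mx_addr_delta.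
exact: is_derive_cvgE.
Qed.

Lemma is_derive_row_mxl m n (g : 'rV[R]_(m + n) -> R) t x i l :
  is_derive (row_mx t x) (delta_mx 0 (lshift n i)) g l ->
  is_derive t (delta_mx 0 i) (fun t : 'rV[R]_m => g (row_mx t x)) l.
Proof.
move=> gd; apply: is_derive_cvg.
under eq_fun do rewrite row_mx_addl_delta.
exact: is_derive_cvgE.
Qed.

Lemma pderivs_row_mx m n (g : 'rV[R]_(m + n) -> R) (s : seq 'I_n) t :
  rsmooth g ->
  pderivs s (fun x => g (row_mx t x)) =
  (fun x => pderivs (map (@rshift m n) s) g (row_mx t x)).
Proof.
move=> sg; elim: s => //= i s ->; apply/funext => x.
have d := is_derive_row_mxr
  (rsmooth_is_derive (rshift m i) (row_mx t x)
    (rsmooth_pderivs (map (@rshift m n) s) sg)).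
by rewrite {1}/pderiv derive_val.
Qed.

Lemma smooth_family_row_mx m n (g : 'rV[R]_(m + n) -> R) : rsmooth g ->
  smooth_family (fun t x => g (row_mx t x)).
Proof.
move=> sg s; split=> [|t i x].
  under [X in continuous X]funext => p do rewrite pderivs_row_mx//.
  move=> p; apply: (@continuous_comp_at _ _ _
    (fun p : 'rV[R]_m * 'rV[R]_n => row_mx p.1 p.2)
    (pderivs (map (@rshift m n) s) g)); last exact: (sg _).1.
  apply: continuous_row_mx; [exact: continuous_fst_at|exact: continuous_snd_at].
rewrite pderivs_row_mx//.
by have [] := is_derive_row_mxr
  (rsmooth_is_derive (rshift m i) (row_mx t x)
    (rsmooth_pderivs (map (@rshift m n) s) sg)).
Qed.

End Families.

(** * Integrals over the torus and characters *)

Section ComplexNorm.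
Context {R : realType}.
Implicit Types z w : R[i].

Lemma normc_ge0 z : 0 <= normc z.
Proof. by case: z => a b; exact: sqrtr_ge0. Qed.

Lemma Re_le_normc z : `|complex.Re z| <= normc z.
Proof.
case: z => a b /=; rewrite -sqrtr_sqr ler_wsqrtr//.
by rewrite lerDl sqr_ge0.
Qed.

Lemma Im_le_normc z : `|complex.Im z| <= normc z.
Proof.
case: z => a b /=; rewrite -sqrtr_sqr ler_wsqrtr//.
by rewrite lerDr sqr_ge0.
Qed.

Lemma normc_le_ReIm z : normc z <= `|complex.Re z| + `|complex.Im z|.
Proof.
case: z => a b /=.
have -> : `|a| + `|b| = Num.sqrt ((`|a| + `|b|) ^+ 2).
  by rewrite sqrtr_sqr (ger0_norm (addr_ge0 (normr_ge0 a) (normr_ge0 b))).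
rewrite ler_wsqrtr//.
rewrite sqrrD !real_normK ?num_real// addrAC lerDl.
by rewrite mulrn_wge0// mulr_ge0.
Qed.

Lemma normc_real (a : R) : normc a%:C%C = `|a|.
Proof. by rewrite /normc/= expr0n/= addr0 sqrtr_sqr. Qed.

Lemma normc_expi (y : R) : normc (expi y) = 1.
Proof. by rewrite /normc/expi/= cos2Dsin2 sqrtr1. Qed.

Lemma complex_eq z w : complex.Re z = complex.Re w ->
  complex.Im z = complex.Im w -> z = w.
Proof. by case: z w => [a b] [c d] /= -> ->. Qed.

Lemma Re_mul z w : complex.Re (z * w) =
  complex.Re z * complex.Re w - complex.Im z * complex.Im w.
Proof. by case: z w => [a b] [c d]. Qed.

Lemma Im_mul z w : complex.Im (z * w) =
  complex.Re z * complex.Im w + complex.Im z * complex.Re w.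
Proof. by case: z w => [a b] [c d]. Qed.

Lemma Re_add z w : complex.Re (z + w) = complex.Re z + complex.Re w.
Proof. by case: z w => [a b] [c d]. Qed.

Lemma Im_add z w : complex.Im (z + w) = complex.Im z + complex.Im w.
Proof. by case: z w => [a b] [c d]. Qed.

Lemma Re_sub z w : complex.Re (z - w) = complex.Re z - complex.Re w.
Proof. by case: z w => [a b] [c d]. Qed.

Lemma Im_sub z w : complex.Im (z - w) = complex.Im z - complex.Im w.
Proof. by case: z w => [a b] [c d]. Qed.

End ComplexNorm.

Section TorusIntegral.
Context {R : realType}.

(** Continuity of a complex-valued function, componentwise. *)
Definition ccontinuous (X : topologicalType) (g : X -> R[i]) : Prop :=
  continuous (fun x => complex.Re (g x)) /\ continuous (fun x => complex.Im (g x)).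

Lemma torus_integral_lin m (a : R[i]) (f g : 'rV[R]_m -> R[i]) :
  ccontinuous f -> ccontinuous g ->
  torus_integral (fun t => a * f t + g t) =
  a * torus_integral f + torus_integral g.
Proof.
move=> [rf If] [rg Ig]; apply: complex_eq => /=.
- under [X in box_integral X]eq_fun do rewrite Re_lin.
  rewrite !box_integral_lin ?Re_lin//=.
  by move=> t; exact: (continuousD (continuousM (@continuous_cst_at _ _ _ t)
    (rf t)) (rg t)).
- under [X in box_integral X]eq_fun do rewrite Im_lin.
  rewrite !box_integral_lin ?Im_lin//=.
  by move=> t; exact: (continuousD (continuousM (@continuous_cst_at _ _ _ t)
    (If t)) (Ig t)).
Qed.

Lemma torus_integral_normc_le m (g : 'rV[R]_m -> R[i]) (M : R) :
  ccontinuous g -> (forall t, normc (g t) <= M) ->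
  normc (torus_integral g) <= 2 * (2 * pi) ^+ m * M.
Proof.
move=> [rg Ig] gM; apply: le_trans (normc_le_ReIm _) _ => /=.
rewrite -mulrA mulr_natl mulr2n lerD//.
- by apply: box_integral_normr_le => // t _; exact: le_trans (Re_le_normc _) _.
- by apply: box_integral_normr_le => // t _; exact: le_trans (Im_le_normc _) _.
Qed.

(** The weight [c] may vanish, in which case [g] need not be bounded. *)
Lemma torus_integral_weighted_le m (g : 'rV[R]_m -> R[i]) (c M : R) :
  ccontinuous g -> 0 <= c -> (forall t, c * normc (g t) <= M) ->
  c * normc (torus_integral g) <= 2 * (2 * pi) ^+ m * M.
Proof.
move=> cg; rewrite le_eqVlt => /predU1P[<-|c0] gM.
  have M0 : 0 <= M by have := gM 0; rewrite mul0r.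
  by rewrite mul0r !mulr_ge0// exprn_ge0// ltW// pi2_gt0.
rewrite -ler_pdivlMl// mulrCA; apply: torus_integral_normc_le => // t.
by rewrite ler_pdivlMl.
Qed.

(** Riemann sums of a Lipschitz function converge to its integral over the
    torus, at a rate that depends only on the Lipschitz constant. *)
Lemma torus_Riemann_sum m (g : 'rV[R]_m -> R[i]) (L : R) (N : nat) :
  (0 < N)%N -> ccontinuous g -> 0 <= L ->
  (forall i h t, normc (g (h *: delta_mx 0 i + t) - g t) <= L * `|h|) ->
  normc (torus_integral g - ((2 * pi / N%:R) ^+ m)%:C%C * grid_sum N g)
  <= 2 * (m%:R * (2 * pi) ^+ m.+1) * L / N%:R.
Proof.
move=> N0 [rg Ig] L0 gL; apply: le_trans (normc_le_ReIm _) _.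
rewrite Re_sub Im_sub Re_mul Im_mul/= !mul0r subr0 addr0.
rewrite (grid_sum_morph (f := @complex.Re R))//; last by move=> ? ?; rewrite Re_add.
rewrite (grid_sum_morph (f := @complex.Im R))//; last by move=> ? ?; rewrite Im_add.
(* The real and the imaginary part contribute an error of [e] each. *)
set e := m%:R * (2 * pi) ^+ m.+1 * L / N%:R.
have -> : 2 * (m%:R * (2 * pi) ^+ m.+1) * L / N%:R = e + e by rewrite /e; ring.
rewrite lerD//.
- apply: Riemann_sum => // i h t; rewrite -Re_sub.
  exact: le_trans (Re_le_normc _) _.
- apply: Riemann_sum => // i h t; rewrite -Im_sub.
  exact: le_trans (Im_le_normc _) _.
Qed.

Lemma zdotN m (k : 'rV[int]_m) (t : 'rV[R]_m) : zdot (- k) t = - zdot k t.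
Proof.
rewrite /zdot -sumrN; apply: eq_bigr => i _.
by rewrite mxE intrN mulNr.
Qed.

Lemma zdot_addl m (k : 'rV[int]_m) (h : R) i (t : 'rV[R]_m) :
  zdot k (h *: delta_mx 0 i + t) = (k 0 i)%:~R * h + zdot k t.
Proof.
rewrite /zdot (eq_bigr (fun j => (k 0 j)%:~R * (h * (j == i)%:R) +
  (k 0 j)%:~R * t 0 j)).
  rewrite big_split/= (bigD1 i)//= eqxx mulr1 big1 ?addr0// => j ji.
  by rewrite (negbTE ji) !mulr0.
by move=> j _; rewrite !mxE eqxx/= mulrDr.
Qed.

Lemma continuous_zdot m (k : 'rV[int]_m) : continuous (zdot (R := R) k).
Proof.
rewrite /zdot; elim: (index_enum _) => [|i s IH] t.
  have -> : (fun t : 'rV[R]_m => \sum_(i <- [::]) (k 0 i)%:~R * t 0 i) = cst 0.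
    by apply/funext => t'; rewrite big_nil.
  exact: continuous_cst_at.
have -> : (fun t : 'rV[R]_m => \sum_(j <- i :: s) (k 0 j)%:~R * t 0 j) =
    (fun t => (k 0 i)%:~R * t 0 i + \sum_(j <- s) (k 0 j)%:~R * t 0 j).
  by apply/funext => t'; rewrite big_cons.
exact: (continuousD (continuousM (@continuous_cst_at _ _ _ t)
  (@coord_continuous _ _ _ 0 i t)) (IH t)).
Qed.

Lemma continuous_cos_zdot m (k : 'rV[int]_m) :
  continuous (fun t : 'rV[R]_m => cos (zdot k t)).
Proof.
by move=> t; apply: (@continuous_comp_at _ _ _ (zdot k) cos);
  [exact: continuous_zdot|exact: continuous_cos].
Qed.

Lemma continuous_sin_zdot m (k : 'rV[int]_m) :
  continuous (fun t : 'rV[R]_m => sin (zdot k t)).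
Proof.
by move=> t; apply: (@continuous_comp_at _ _ _ (zdot k) sin);
  [exact: continuous_zdot|exact: continuous_sin].
Qed.

Lemma ccontinuous_expi m (k : 'rV[int]_m) :
  ccontinuous (fun t : 'rV[R]_m => expi (zdot k t)).
Proof. by split; [exact: continuous_cos_zdot|exact: continuous_sin_zdot]. Qed.

Lemma ccontinuousM (X : topologicalType) (f g : X -> R[i]) :
  ccontinuous f -> ccontinuous g -> ccontinuous (fun x => f x * g x).
Proof.
move=> [rf If] [rg Ig]; split.
- under [X in continuous X]funext => x do rewrite Re_mul.
  by move=> x; exact: (continuousB (continuousM (rf x) (rg x))
    (continuousM (If x) (Ig x))).
- under [X in continuous X]funext => x do rewrite Im_mul.
  by move=> x; exact: (continuousD (continuousM (rf x) (Ig x))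
    (continuousM (If x) (rg x))).
Qed.

Lemma expi_lipschitz (a b : R) : normc (expi b - expi a) <= 2 * `|b - a|.
Proof.
apply: le_trans (normc_le_ReIm _) _.
rewrite Re_sub Im_sub/= mulr_natl mulr2n lerD//.
- have [c _ ->] := MVT_between a b (fun x => is_derive_cos x).
  by rewrite normrM normrN ler_piMl// ler_norml sin_geN1 sin_le1.
- have [c _ ->] := MVT_between a b (fun x => is_derive_sin x).
  by rewrite normrM ler_piMl// ler_norml cos_geN1 cos_le1.
Qed.

Lemma is_derive_affine (a b x : R) :
  is_derive x 1 (fun h : R => a * h + b) a.
Proof.
apply: is_derive_cvg; apply: cvg_near_cst.
near=> h; have h0 : h != 0 by near: h; exact: nbhs_dnbhs_neq.
rewrite /GRing.scale/= mulr1; field.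
exact: h0.
Unshelve. all: end_near. Qed.

Lemma is_derive_cos_zdot m (k : 'rV[int]_m) i (t : 'rV[R]_m) :
  is_derive t (delta_mx 0 i) (fun t => cos (zdot k t))
    (- (k 0 i)%:~R * sin (zdot k t)).
Proof.
apply: is_derive_cvg.
under eq_fun do rewrite zdot_addl.
have d := @is_derive1_comp R cos (fun h => (k 0 i)%:~R * h + zdot k t) 0 _ _
  (is_derive_cos ((k 0 i)%:~R * 0 + zdot k t))
  (is_derive_affine (k 0 i)%:~R (zdot k t) 0).
rewrite [X in is_derive _ _ _ X](_ : _ = - (k 0 i)%:~R * sin (zdot k t)) in d;
  last by rewrite mulr0 add0r mulNr mulNr mulrC.
have := is_derive_cvgE d; rewrite /comp mulr0 add0r => c.
apply: cvg_trans c; apply: near_eq_cvg; near=> h.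
by rewrite [h *: 1]mulr1 addr0.
Unshelve. all: end_near. Qed.

Lemma is_derive_sin_zdot m (k : 'rV[int]_m) i (t : 'rV[R]_m) :
  is_derive t (delta_mx 0 i) (fun t => sin (zdot k t))
    ((k 0 i)%:~R * cos (zdot k t)).
Proof.
apply: is_derive_cvg.
under eq_fun do rewrite zdot_addl.
have d := @is_derive1_comp R sin (fun h => (k 0 i)%:~R * h + zdot k t) 0 _ _
  (is_derive_sin ((k 0 i)%:~R * 0 + zdot k t))
  (is_derive_affine (k 0 i)%:~R (zdot k t) 0).
rewrite [X in is_derive _ _ _ X](_ : _ = (k 0 i)%:~R * cos (zdot k t)) in d;
  last by rewrite mulr0 add0r mulrC.
have := is_derive_cvgE d; rewrite /comp mulr0 add0r => c.
apply: cvg_trans c; apply: near_eq_cvg; near=> h.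
by rewrite [h *: 1]mulr1 addr0.
Unshelve. all: end_near. Qed.

Lemma cos_sin_period (n : nat) (x : R) :
  cos (x + 2 * pi * n%:R) = cos x /\ sin (x + 2 * pi * n%:R) = sin x.
Proof.
elim: n => [|n [IHc IHs]]; first by rewrite mulr0 addr0.
have -> : x + 2 * pi * n.+1%:R = x + 2 * pi * n%:R + pi *+ 2.
  by rewrite -[n.+1]addn1 natrD; ring.
by rewrite cosD2pi sinD2pi.
Qed.

Lemma expi_period (k : int) (x : R) : expi (k%:~R * (2 * pi) + x) = expi x.
Proof.
rewrite /expi addrC mulrC; case: k => n.
  by have [-> ->] := cos_sin_period n x.
rewrite NegzE; set y := x + _.
have -> : x = y + 2 * pi * n.+1%:R.
  by rewrite /y mulrNz mulrN subrK.
by have [-> ->] := cos_sin_period n.+1 y.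
Qed.

End TorusIntegral.

(** * Fourier coefficients in the torus variables *)

Section ComplexFamilies.
Context {R : realType}.

(** Complex-valued smooth families, componentwise. *)
Definition csmooth_family m n (Phi : 'rV[R]_m -> 'rV[R]_n -> R[i]^o) : Prop :=
  smooth_family (fun t x => complex.Re (Phi t x)) /\
  smooth_family (fun t x => complex.Im (Phi t x)).

Lemma csmooth_family_smooth m n (Phi : 'rV[R]_m -> 'rV[R]_n -> R[i]^o) t :
  csmooth_family Phi -> smooth (Phi t).
Proof.
by move=> [P Q]; split; [exact: (smooth_family_rsmooth t P)|
  exact: (smooth_family_rsmooth t Q)].
Qed.

Lemma csmooth_family_continuous m n (Phi : 'rV[R]_m -> 'rV[R]_n -> R[i]^o)
    s x : csmooth_family Phi -> ccontinuous (fun t => cderivs s (Phi t) x).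
Proof.
move=> [P Q]; rewrite /ccontinuous /cderivs /=; split.
  exact: (smooth_family_continuous P).
exact: (smooth_family_continuous Q).
Qed.

(** Differentiation under the integral over the torus. *)
Lemma cderivs_torus_integral m n (Phi : 'rV[R]_m -> 'rV[R]_n -> R[i]^o) :
  csmooth_family Phi ->
  smooth (fun x => torus_integral (fun t => Phi t x) : R[i]^o) /\
  forall s x, cderivs s (fun x => torus_integral (fun t => Phi t x)) x =
    torus_integral (fun t => cderivs s (Phi t) x).
Proof.
move=> [/pderivs_box_integral[sP eP] /pderivs_box_integral[sQ eQ]].
split; first exact: conj sP sQ.
by move=> s x; apply: complex_eq => /=; [exact: eP|exact: eQ].
Qed.

Lemma csmooth_family_row_mx m n (f : 'rV[R]_(m + n) -> R[i]^o) : smooth f ->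
  csmooth_family (fun t x => f (row_mx t x)).
Proof.
by move=> [rf If]; split; [exact: smooth_family_row_mx rf|
  exact: smooth_family_row_mx If].
Qed.

Lemma smooth_family0 m n : smooth_family
    (fun (_ : 'rV[R]_m) (_ : 'rV[R]_n) => 0 : R).
Proof.
move=> s; rewrite pderivs0; split; first exact: cst_continuous.
by move=> t i x; exact: derivable_cst.
Qed.

Lemma csmooth_familyM m n (a : 'rV[R]_m -> R[i])
    (Phi : 'rV[R]_m -> 'rV[R]_n -> R[i]^o) : ccontinuous a ->
  csmooth_family Phi -> csmooth_family (fun t x => Phi t x * a t).
Proof.
move=> [ra Ia] [P Q]; split.
- have -> : (fun t x => complex.Re (Phi t x * a t)) =
    (fun t x => complex.Re (a t) * complex.Re (Phi t x) +
      (- complex.Im (a t) * complex.Im (Phi t x) + 0)).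
    by apply/funext => t; apply/funext => x; rewrite Re_mul; ring.
  have nIa : continuous (fun t => - complex.Im (a t)).
    by move=> t; exact: continuousN (Ia t).
  exact: (smooth_family_lin ra P (smooth_family_lin nIa Q (@smooth_family0 m n))).
- have -> : (fun t x => complex.Im (Phi t x * a t)) =
    (fun t x => complex.Im (a t) * complex.Re (Phi t x) +
      (complex.Re (a t) * complex.Im (Phi t x) + 0)).
    by apply/funext => t; apply/funext => x; rewrite Im_mul; ring.
  exact: (smooth_family_lin Ia P (smooth_family_lin ra Q (@smooth_family0 m n))).
Qed.

Lemma cderivs_row_mx m n (f : 'rV[R]_(m + n) -> R[i]^o) s t x : smooth f ->
  cderivs s (fun x => f (row_mx t x)) x =
  cderivs (map (@rshift m n) s) f (row_mx t x).
Proof.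
by move=> [rf If]; rewrite /cderivs (pderivs_row_mx s t rf)
  (pderivs_row_mx s t If).
Qed.

Lemma smooth_cderivs d (s : seq 'I_d) (f : 'rV[R]_d -> R[i]^o) :
  smooth f -> smooth (cderivs s f : _ -> R[i]^o).
Proof.
by move=> [rf If]; split; [exact: (rsmooth_pderivs s rf)|
  exact: (rsmooth_pderivs s If)].
Qed.

Lemma cderivs_cat d (s1 s2 : seq 'I_d) (f : 'rV[R]_d -> R[i]^o) :
  cderivs (s1 ++ s2) f = cderivs s1 (cderivs s2 f : _ -> R[i]^o).
Proof. by apply/funext => x; rewrite /cderivs/= !pderivs_cat. Qed.

(** A derivative taken last may be taken first. *)
Lemma cderivs_catC d (i : 'I_d) (s : seq 'I_d) (f : 'rV[R]_d -> R[i]^o) :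
  smooth f -> cderivs (i :: s) f = cderivs (s ++ [:: i]) f.
Proof.
move=> [rf If]; apply/funext => x; rewrite /cderivs !pderivs_cat/=.
by rewrite (pderivs_pderivC s i rf) (pderivs_pderivC s i If).
Qed.

Lemma periodic_cderivs m n (s : seq 'I_(m + n)) (f : 'rV[R]_(m + n) -> R[i]^o) :
  Defs.periodic f -> Defs.periodic (cderivs s f : _ -> R[i]^o).
Proof.
move=> pf i z; have e := pf i; rewrite /cderivs.
rewrite (pderivs_periodic s (g := fun y => complex.Re (f y))).
  rewrite (pderivs_periodic s (g := fun y => complex.Im (f y)))// => y.
  by rewrite e.
by move=> y; rewrite e.
Qed.

Lemma cderivsZ d (s : seq 'I_d) (a : R[i]) (f : 'rV[R]_d -> R[i]^o) x :
  smooth f -> cderivs s (a *: f) x = a * cderivs s f x.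
Proof.
move=> sf; have := cderivs_lin s a x sf (@smooth0 R d).
by rewrite addr0 cderivs0 addr0.
Qed.

Lemma cderivsD d (s : seq 'I_d) (f g : 'rV[R]_d -> R[i]^o) x :
  smooth f -> smooth g -> cderivs s (f + g) x = cderivs s f x + cderivs s g x.
Proof.
by move=> sf sg; have := cderivs_lin s 1 x sf sg; rewrite scale1r mul1r.
Qed.

Lemma cderivsB d (s : seq 'I_d) (f g : 'rV[R]_d -> R[i]^o) x :
  smooth f -> smooth g -> cderivs s (f - g) x = cderivs s f x - cderivs s g x.
Proof.
move=> sf sg; have := cderivs_lin s (-1) x sg sf.
by rewrite scaleN1r mulN1r addrC => ->; rewrite addrC.
Qed.

Lemma smoothZ d (a : R[i]) (f : 'rV[R]_d -> R[i]^o) : smooth f -> smooth (a *: f).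
Proof.
by move=> sf; rewrite -[a *: f]addr0; exact: smooth_lin (@smooth0 R d).
Qed.

(** The factor 2 comes from bounding the two components separately. *)
Lemma lipschitz_cderivs d (i : 'I_d) (f : 'rV[R]_d -> R[i]^o) (c M h : R)
    (x : 'rV[R]_d) :
  smooth f -> 0 <= c ->
  (forall a, c * normc (cderivs [:: i] f (a *: delta_mx 0 i + x)) <= M) ->
  c * normc (f (h *: delta_mx 0 i + x) - f x) <= 2 * M * `|h|.
Proof.
move=> [rf If] c0 fM.
apply: le_trans (ler_wpM2l c0 (normc_le_ReIm _)) _.
rewrite Re_sub Im_sub -mulrA mulr_natl mulr2n mulrDr lerD//.
- apply: (lipschitz_pderiv _ rf) => // a; apply: le_trans (fM a).
  exact: (ler_wpM2l c0 (Re_le_normc (cderivs [:: i] f _))).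
- apply: (lipschitz_pderiv _ If) => // a; apply: le_trans (fM a).
  exact: (ler_wpM2l c0 (Im_le_normc (cderivs [:: i] f _))).
Qed.

End ComplexFamilies.

Section TorusCoefficients.
Context {R : realType}.

(** The slice f(t, .) of a function on the torus times R^n, multiplied by the
    character exp(i k . t). *)
Definition twisted_slice m n (f : 'rV[R]_(m + n) -> R[i]^o) (k : 'rV[int]_m)
    (t : 'rV[R]_m) : 'rV[R]_n -> R[i]^o :=
  fun x => f (row_mx t x) * expi (zdot k t).

(** The Fourier coefficient of f at [- k], without the factor (2 pi) ^ (- m). *)
Definition torus_coef m n (f : 'rV[R]_(m + n) -> R[i]^o) (k : 'rV[int]_m) :
    'rV[R]_n -> R[i]^o :=
  fun x => torus_integral (fun t => twisted_slice f k t x).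

Variables m n : nat.
Implicit Types (f : 'rV[R]_(m + n) -> R[i]^o) (k : 'rV[int]_m).

Lemma fourier_coefE f k :
  fourier_coef f (- k) = ((2 * pi) ^- m)%:C%C *: torus_coef f k.
Proof.
apply/funext => x; rewrite /fourier_coef /torus_coef /twisted_slice.
congr (_ * torus_integral _); apply/funext => t.
by rewrite zdotN opprK.
Qed.

Lemma csmooth_twisted_slice f k : smooth f ->
  csmooth_family (twisted_slice f k).
Proof.
move=> sf; apply: csmooth_familyM; first exact: ccontinuous_expi.
exact: csmooth_family_row_mx.
Qed.

Lemma cderivs_twisted_slice f k t s x : smooth f ->
  cderivs s (twisted_slice f k t) x =
  twisted_slice (cderivs (map (@rshift m n) s) f : _ -> R[i]^o) k t x.
Proof.
move=> sf; have sl := csmooth_family_smooth t (csmooth_family_row_mx sf).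
have -> : twisted_slice f k t = expi (zdot k t) *: (fun x => f (row_mx t x)).
  by apply/funext => y; rewrite /twisted_slice mulrC.
by rewrite cderivsZ// cderivs_row_mx// /twisted_slice mulrC.
Qed.

Lemma smooth_torus_coef f k : smooth f -> smooth (torus_coef f k).
Proof.
by move=> sf; have [] := cderivs_torus_integral (csmooth_twisted_slice k sf).
Qed.

Lemma cderivs_torus_coef f k s : smooth f ->
  cderivs s (torus_coef f k) =
  torus_coef (cderivs (map (@rshift m n) s) f : _ -> R[i]^o) k.
Proof.
move=> sf; apply/funext => x.
have [_ ->] := cderivs_torus_integral (csmooth_twisted_slice k sf).
rewrite /torus_coef; congr torus_integral; apply/funext => t.
exact: cderivs_twisted_slice.
Qed.

Lemma ccontinuous_twisted_slice f k x : smooth f ->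
  ccontinuous (fun t => twisted_slice f k t x).
Proof.
move=> sf; exact: (csmooth_family_continuous [::] x
  (csmooth_twisted_slice k sf)).
Qed.

Lemma torus_coef_lin f g k (a : R[i]) : smooth f -> smooth g ->
  torus_coef (a *: f + g) k = a *: torus_coef f k + torus_coef g k.
Proof.
move=> sf sg; apply/funext => x; rewrite /torus_coef.
transitivity (torus_integral (fun t =>
  a * twisted_slice f k t x + twisted_slice g k t x)).
  congr torus_integral; apply/funext => t.
  by rewrite /twisted_slice mulrA -mulrDl.
by rewrite torus_integral_lin//; exact: ccontinuous_twisted_slice.
Qed.

(** Integration by parts in the torus variables. *)
Lemma torus_coef_by_parts f k i : smooth f -> Defs.periodic f ->
  torus_coef (cderivs [:: lshift n i] f : _ -> R[i]^o) k =
  (0 +i* - (k 0 i)%:~R)%C *: torus_coef f k.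
Proof.
move=> sf pf; apply/funext => x; set j := lshift n i; set a := (k 0 i)%:~R.
set f' := (cderivs [:: j] f : _ -> R[i]^o).
have sf' : smooth f' by exact: smooth_cderivs.
have [rg Ig] := ccontinuous_twisted_slice k x sf.
have [rg' Ig'] := ccontinuous_twisted_slice k x sf'.
have gp t : twisted_slice f k ((2 * pi) *: delta_mx 0 i + t) x =
    twisted_slice f k t x.
  rewrite /twisted_slice row_mx_addl_delta zdot_addl expi_period.
  by rewrite [_ *: _ + _]addrC pf.
have dR t : is_derive t (delta_mx 0 i)
    (fun t : 'rV[R]_m => complex.Re (f (row_mx t x))) (complex.Re (f' (row_mx t x))).
  exact: (is_derive_row_mxl (rsmooth_is_derive j (row_mx t x) sf.1)).
have dI t : is_derive t (delta_mx 0 i)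
    (fun t : 'rV[R]_m => complex.Im (f (row_mx t x))) (complex.Im (f' (row_mx t x))).
  exact: (is_derive_row_mxl (rsmooth_is_derive j (row_mx t x) sf.2)).
have dc t := is_derive_cos_zdot k i t.
have ds t := is_derive_sin_zdot k i t.
have bR : box_integral (fun t => complex.Re (twisted_slice f' k t x) -
    a * complex.Im (twisted_slice f k t x)) = 0.
  apply: (box_integral_derive_periodic (i := i)
    (g := fun t => complex.Re (twisted_slice f k t x))) => //.
  - move=> t; exact: (continuousB (rg' t)
      (continuousM (@continuous_cst_at _ _ a t) (Ig t))).
  - move=> t; under eq_fun do rewrite Re_mul/=.
    apply: is_derive_eq.
    by rewrite Re_mul Im_mul/= /GRing.scale/=; ring.
  - by move=> t; rewrite gp.
have bI : box_integral (fun t => complex.Im (twisted_slice f' k t x) -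
    - a * complex.Re (twisted_slice f k t x)) = 0.
  apply: (box_integral_derive_periodic (i := i)
    (g := fun t => complex.Im (twisted_slice f k t x))) => //.
  - move=> t; exact: (continuousB (Ig' t)
      (continuousM (@continuous_cst_at _ _ (- a) t) (rg t))).
  - move=> t; under eq_fun do rewrite Im_mul/=.
    apply: is_derive_eq.
    by rewrite Re_mul Im_mul/= /GRing.scale/=; ring.
  - by move=> t; rewrite gp.
have cZ (b : R) (q : 'rV[R]_m -> R) : continuous q ->
    continuous (fun t => b * q t).
  by move=> cq t; exact: (continuousM (@continuous_cst_at _ _ b t) (cq t)).
rewrite box_integralB ?box_integralZ// in bR; last exact: cZ.
rewrite box_integralB ?box_integralZ// in bI; last exact: cZ.
move/eqP: bR; rewrite subr_eq0 => /eqP bR.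
move/eqP: bI; rewrite subr_eq0 => /eqP bI.
apply: complex_eq.
  by rewrite [RHS]Re_mul mul0r sub0r mulNr opprK; exact: bR.
by rewrite [RHS]Im_mul mul0r add0r; exact: bI.
Qed.

(** Each factor |k_i| is traded for a derivative in t_i. The t-derivatives are
    the innermost ones, in the same order as in the seminorms. *)
Lemma torus_coef_iter_by_parts f k i r s x : smooth f -> Defs.periodic f ->
  `|(k 0 i)%:~R| ^+ r * normc (cderivs s (torus_coef f k) x) =
  normc (torus_coef (cderivs (map (@rshift m n) s ++ nseq r (lshift n i)) f
    : _ -> R[i]^o) k x).
Proof.
elim: r f => [|r IH] f sf pf.
  by rewrite expr0 mul1r cats0 cderivs_torus_coef.
pose f' := (cderivs [:: lshift n i] f : _ -> R[i]^o).
have := IH f' (smooth_cderivs _ sf) (periodic_cderivs _ pf).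
rewrite -cderivs_cat -catA.
have -> : nseq r (lshift n i) ++ [:: lshift n i] = nseq r.+1 (lshift n i).
  by rewrite -[r.+1]addn1 nseqD.
move=> <-; rewrite torus_coef_by_parts// cderivsZ; last exact: smooth_torus_coef.
rewrite normcM exprSr -mulrA; congr (_ * (_ * _)).
by rewrite /normc/= expr0n/= add0r sqrtr_sqr normrN.
Qed.

End TorusCoefficients.

(** * Exponential decay and sums over the lattice *)

Section Exponential.
Context {R : realType}.

Lemma sum_half_le2 (N : nat) : \sum_(0 <= i < N) (2^-1 : R) ^+ i <= 2.
Proof.
have -> : \sum_(0 <= i < N) (2^-1 : R) ^+ i = 2 - 2 * 2^-1 ^+ N.
  elim: N => [|N IH]; first by rewrite big_nil expr0 mulr1 subrr.
  by rewrite big_nat_recr//= IH exprS; field.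
by rewrite lerBlDr lerDl mulr_ge0// exprn_ge0// invr_ge0.
Qed.

(** Term by term comparison of the exponential series of a / 2 with a geometric
    series. *)
Lemma expR_half_le (a Q : R) : 0 <= a ->
  (forall r, a ^+ r / r`!%:R <= Q) -> expR (a / 2) <= 2 * Q.
Proof.
move=> a0 aQ; rewrite /expR/=; apply: limr_le.
  exact: is_cvg_series_exp_coeff.
near=> N; rewrite /series/=.
apply: (@le_trans _ _ (\sum_(0 <= i < N) Q * (2^-1 : R) ^+ i)).
  apply: ler_sum => i _; rewrite /exp_coeff/= exprMn mulrAC.
  by rewrite ler_wpM2r// exprn_ge0// invr_ge0.
have Q0 : 0 <= Q by have := aQ 0%N; rewrite expr0 fact0 divr1; exact: le_trans.
by rewrite -mulr_sumr mulrC ler_wpM2r// sum_half_le2.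
Unshelve. all: end_near. Qed.

(** Bounds of all orders with powers of factorials amount to an exponential decay
    in the power 1 / sigma. *)
Lemma factorial_bounds_decay (sigma C y D M : R) :
  0 < sigma -> 0 < C -> 0 <= y -> 0 <= D ->
  (forall r, y ^+ r * D <= M * C ^+ r * r`!%:R `^ sigma) ->
  D <= 2 `^ sigma * M * expR (- (sigma / 2) * (y / C) `^ sigma^-1).
Proof.
move=> s0 C0 y0; have [->|Dn0 D0] := eqVneq D 0.
  move=> _ b; have := b 0%N; rewrite !expr0 mulr1 fact0 powR1 mulr1 mulr0.
  by move=> M0; rewrite !mulr_ge0 ?powR_ge0 ?expR_ge0.
have {D0}D0 : 0 < D by rewrite lt_neqAle eq_sym Dn0.
move=> b; have M0 : 0 <= M.
  have := b 0%N; rewrite !expr0 mulr1 fact0 powR1 mulr1 mul1r.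
  exact: le_trans (ltW D0).
(* The hypothesis says that a ^ r / r! <= Q for all r. *)
set a := (y / C) `^ sigma^-1; pose Q := (M / D) `^ sigma^-1.
have sV0 : 0 <= sigma^-1 by rewrite invr_ge0 ltW.
have powK (x : R) : 0 <= x -> (x `^ sigma) `^ sigma^-1 = x.
  by move=> x0; rewrite -powRrM divff ?gt_eqF// powRr1.
have powVK (x : R) : 0 <= x -> (x `^ sigma^-1) `^ sigma = x.
  by move=> x0; rewrite -powRrM mulVf ?gt_eqF// powRr1.
have yC0 : 0 <= y / C by rewrite divr_ge0// ltW.
have MD0 : 0 <= M / D by rewrite divr_ge0// ltW.
have a0 : 0 <= a by exact: powR_ge0.
have Q0 : 0 <= Q by exact: powR_ge0.
have eQ : expR (a / 2) <= 2 * Q.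
  apply: expR_half_le => // r; rewrite ler_pdivrMr ?ltr0n ?fact_gt0//.
  have ar0 : 0 <= a ^+ r by exact: exprn_ge0.
  have Qr0 : 0 <= Q * r`!%:R by rewrite mulr_ge0.
  rewrite -(powK _ ar0) -(powK _ Qr0).
  apply: ge0_ler_powR; rewrite ?nnegrE ?powR_ge0//.
  rewrite powRM// powVK// -powR_mulrn// powRAC powVK// powR_mulrn//.
  rewrite expr_div_n ler_pdivrMr ?exprn_gt0//.
  have -> : M / D * r`!%:R `^ sigma * C ^+ r = M * C ^+ r * r`!%:R `^ sigma / D.
    by ring.
  by rewrite ler_pdivlMr.
have : expR (a / 2) `^ sigma <= (2 * Q) `^ sigma.
  by apply: ge0_ler_powR; rewrite ?nnegrE ?expR_ge0 ?mulr_ge0 ?(ltW s0).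
rewrite -expRM powRM// powVK// => e.
rewrite mulNr expRN ler_pdivlMr ?expR_gt0//.
have -> : sigma / 2 * a = a / 2 * sigma by ring.
rewrite mulrC -ler_pdivlMr//.
by rewrite (le_trans e)// mulrA.
Qed.

(** If D decays exponentially in each y_i, it does so in their sum: some y_i is
    at least the sum divided by [#|I|.+1], unless the sum is zero. The divisor
    [#|I|.+1] also covers an empty [I], for which the bound D <= B is needed. *)
Lemma expR_average_le (I : finType) (y : I -> R) (B D c : R) :
  0 < c -> 0 <= B -> (forall i, 0 <= y i) -> D <= B ->
  (forall i, D <= B * expR (- c * y i)) ->
  D <= B * expR (- (c / #|I|.+1%:R) * \sum_i y i).
Proof.
move=> c0 B0 y0 DB Di; set S := \sum_i y i.
have n0 : 0 < #|I|.+1%:R :> R by rewrite ltr0n.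
have S0 : 0 <= S by exact: sumr_ge0.
have [[i iS]|noi] := pselect (exists i, S / #|I|.+1%:R <= y i).
  apply: le_trans (Di i) _; rewrite ler_wpM2l// ler_expR.
  by rewrite -!mulNr [X in _ <= X]mulrAC -mulrA ler_nM2l ?oppr_lt0// mulrC.
have yS i : y i <= S / #|I|.+1%:R.
  by rewrite leNgt; apply/negP => yi; apply: noi; exists i; exact: ltW.
have : S <= #|I|%:R * (S / #|I|.+1%:R).
  apply: le_trans (ler_sum _ (fun i _ => yS i)) _.
  by rewrite sumr_const mulr_natl.
rewrite mulrA ler_pdivlMr// -natr1 mulrDr mulr1 mulrC gerDl => Sle0.
have -> : S = 0 by apply/eqP; rewrite eq_le Sle0.
by rewrite mulr0 expR0 mulr1.
Qed.

(** Subadditivity of the power [p] in ]0, 1]. *)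
Lemma powR_sum_le (I : finType) (y : I -> R) (p : R) :
  0 < p -> p <= 1 -> (forall i, 0 <= y i) ->
  (\sum_i y i) `^ p <= \sum_i y i `^ p.
Proof.
move=> p0 p1 y0; set S := \sum_i y i.
have : 0 <= S by exact: sumr_ge0.
rewrite le_eqVlt.
case/predU1P => [<-|S0].
  by rewrite powR0 ?gt_eqF//; apply: sumr_ge0 => i _; exact: powR_ge0.
have -> : S `^ p = \sum_i S `^ p * (y i / S).
  by rewrite -mulr_sumr -mulr_suml -/S divff ?gt_eqF// mulr1.
apply: ler_sum => i _.
have -> : y i = S * (y i / S) by rewrite mulrC divfK// gt_eqF.
rewrite [X in _ <= X]powRM ?divr_ge0 ?(ltW S0)//.
rewrite ler_wpM2l ?powR_ge0// [S * _]mulrC divfK ?gt_eqF//.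
have [->|yn0] := eqVneq (y i) 0; first by rewrite mul0r powR_ge0.
apply: ger1_powR => //; rewrite divr_gt0//=; last first.
  by rewrite lt_neqAle eq_sym yn0 y0.
by rewrite ler_pdivrMr// mul1r /S (bigD1 i)//= lerDl sumr_ge0.
Qed.

Lemma znorm_powR_le m (k : 'rV[int]_m) (p : R) : 0 < p -> p <= 1 ->
  znorm k `^ p <= \sum_i `|(k 0 i)%:~R| `^ p.
Proof.
move=> p0 p1; apply: le_trans (powR_sum_le p0 p1 _); last by [].
have S0 : 0 <= \sum_i `|(k 0 i)%:~R : R| by exact: sumr_ge0.
apply: ge0_ler_powR; rewrite ?nnegrE ?sqrtr_ge0 ?(ltW p0)//.
rewrite /znorm -[leRHS](ger0_norm S0) -sqrtr_sqr ler_wsqrtr//.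
rewrite expr2 mulr_sumr; apply: ler_sum => i _.
rewrite -real_normK ?num_real// expr2 ler_wpM2r//.
by rewrite (bigD1 i)//= lerDl sumr_ge0.
Qed.

End Exponential.

Section LatticeSums.
Context {R : realType}.

Lemma sum_subset_le (T : eqType) (s t : seq T) (f : T -> R) :
  uniq s -> uniq t -> {subset s <= t} -> (forall x, 0 <= f x) ->
  \sum_(x <- s) f x <= \sum_(x <- t) f x.
Proof.
move=> us ut st f0; rewrite [leRHS](bigID (mem s))/=.
have -> : \sum_(x <- t | x \in s) f x = \sum_(x <- s) f x.
  rewrite -big_filter; apply: perm_big; apply: uniq_perm => //.
    exact: filter_uniq.
  by move=> x; rewrite mem_filter; case: (boolP (x \in s)) => // /st ->.
by rewrite lerDl sumr_ge0.
Qed.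

Lemma sum_inv_sqr_le (N : nat) : \sum_(0 <= i < N) (i.+1%:R ^- 2 : R) <= 2.
Proof.
case: N => [|N]; first by rewrite big_nil.
suff : \sum_(0 <= i < N.+1) (i.+1%:R ^- 2 : R) <= 2 - N.+1%:R^-1.
  by move/le_trans; apply; rewrite gerBl invr_ge0.
elim: N => [|N IH].
  by rewrite big_nat1 expr1n invr1; lra.
rewrite big_nat_recr//= (le_trans (lerD IH (lexx _)))//.
have n0 : 0 < N%:R + 1 :> R by rewrite ltr_wpDl.
have n1 : 0 < N%:R + 1 + 1 :> R by rewrite ltr_wpDl// ltW.
rewrite -[N.+2%:R]natr1 -[N.+1%:R]natr1.
rewrite -addrA lerD2l -subr_ge0.
rewrite (_ : _ - _ = (N%:R + 1)^-1 * (N%:R + 1 + 1) ^- 2); last first.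
  by field; rewrite !gt_eqF.
by rewrite mulr_ge0// invr_ge0 ltW// exprn_gt0.
Qed.

(** exp (- b |j| ^ p) is summable over the integers. *)
Lemma sum_exp_int (b p : R) : 0 < b -> 0 < p ->
  exists2 B : R, 0 <= B & forall s : seq int, uniq s ->
    \sum_(j <- s) expR (- b * `|j%:~R| `^ p) <= B.
Proof.
move=> b0 p0; set w := fun j : int => expR (- b * `|j%:~R| `^ p).
(* Comparison with the term of order [N.+1] in the series of exp (b |j| ^ p),
   which grows at least like |j| ^ 2. *)
have [N Np] : exists N : nat, 2 <= N.+1%:R * p.
  exists (Num.truncn (2 / p)); rewrite -ler_pdivrMr//.
  by rewrite ltW// truncnS_gt.
pose c := N.+1`!%:R / b ^+ N.+1.
have c0 : 0 <= c by rewrite divr_ge0// exprn_ge0// ltW.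
have wE (i : nat) (j : int) : `|j%:~R| = i.+1%:R :> R -> w j <= c * i.+1%:R ^- 2.
  move=> ji; rewrite /w ji mulNr expRN.
  have i0 : 0 < i.+1%:R :> R by rewrite ltr0n.
  have x0 : 0 <= b * i.+1%:R `^ p by rewrite mulr_ge0 ?powR_ge0// ltW.
  have := expR_ge1Dxn N x0; set E := expR _ => le.
  have E0 : 0 < E by exact: expR_gt0.
  have {}le : (b * i.+1%:R `^ p) ^+ N.+1 / N.+1`!%:R <= E.
    by apply: le_trans le; rewrite lerDr.
  rewrite -[E^-1]mul1r ler_pdivrMr// mulrAC ler_pdivlMr ?exprn_gt0// mul1r.
  rewrite /c mulrAC ler_pdivlMr ?exprn_gt0//.
  rewrite ler_pdivrMr ?ltr0n ?fact_gt0// in le.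
  rewrite [_ * E]mulrC; apply: le_trans le; rewrite exprMn mulrC.
  rewrite ler_wpM2l ?exprn_ge0 ?(ltW b0)//.
  rewrite -powR_mulrn ?(ltW i0)// -[leRHS]powR_mulrn ?powR_ge0// -powRrM.
  by apply: ler_powR; rewrite ?ler1n// mulrC.
exists (1 + 4 * c) => [|s us]; first by rewrite addr_ge0// mulr_ge0.
have [N0 sN0] : exists N0, forall j, j \in s -> (`|j| < N0)%N.
  by exists (\max_(j <- s) `|j|%N).+1 => j js; rewrite ltnS; exact: leq_bigmax_seq.
pose t := [:: 0%:Z] ++ [seq Posz i.+1 | i <- iota 0 N0] ++
  [seq Negz i | i <- iota 0 N0].
have st : {subset s <= t}.
  move=> j /sN0; rewrite /t !mem_cat; case: j => [[|i]|i] /= jN //.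
  - apply/orP; left; apply/mapP; exists i => //.
    by rewrite mem_iota add0n/=; exact: ltnW.
  - apply/orP; right; apply/mapP; exists i => //.
    by rewrite mem_iota add0n/=; exact: ltnW.
have ut : uniq t.
  rewrite /t !cat_uniq/= !map_inj_uniq ?iota_uniq/=; [|by move=> ? ? []..].
  rewrite andbT; apply/andP; split.
    apply/hasPn => x; rewrite mem_cat inE => /orP[] /mapP[i _ ->] //.
  by apply/hasPn => x /mapP[i _ ->]; apply/mapP => -[].
apply: le_trans (sum_subset_le us ut st (fun j => expR_ge0 _)) _.
rewrite /t big_cat big_seq1/= big_cat/= !big_map.
apply: lerD; first by rewrite normr0 powR0 ?gt_eqF// mulr0 expR0.
have tail (f : nat -> int) : (forall i, `|(f i)%:~R| = i.+1%:R :> R) ->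
    \sum_(i <- iota 0 N0) w (f i) <= 2 * c.
  move=> fE; apply: (@le_trans _ _ (\sum_(i <- iota 0 N0) c * i.+1%:R ^- 2)).
    by apply: ler_sum => i _; exact: wE.
  rewrite -mulr_sumr mulrC ler_wpM2r//.
  by have := sum_inv_sqr_le N0; rewrite /index_iota subn0.
have -> : 4 * c = 2 * c + 2 * c by ring.
apply: lerD; apply: tail => i.
- by rewrite ger0_norm.
- by rewrite NegzE mulrNz normrN ger0_norm.
Qed.

(** The sum over a box of the lattice is a product of sums over the integers, and
    every finite part of the lattice is contained in such a box. *)
Lemma sum_exp_lattice m (b p : R) : 0 < b -> 0 < p ->
  exists2 B : R, 0 <= B & forall A : seq 'rV[int]_m, uniq A ->
    \sum_(k <- A) expR (- b * \sum_i `|(k 0 i)%:~R| `^ p) <= B.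
Proof.
move=> b0 p0; have [B B0 sB] := sum_exp_int b0 p0.
exists (B ^+ m) => [|A uA]; first exact: exprn_ge0.
pose w j := expR (- b * `|j%:~R : R| `^ p).
pose s := undup (flatten [seq [seq k 0 i | i <- enum 'I_m] | k : 'rV[int]_m <- A]).
have us : uniq s by exact: undup_uniq.
(* The points of the box s ^ m, indexed by functions into the indices of [s]. *)
pose row (phi : {ffun 'I_m -> 'I_(size s)}) : 'rV[int]_m :=
  \row_i nth 0 s (phi i).
have row_inj : injective row.
  move=> phi psi /rowP e; apply/ffunP => i; have := e i; rewrite !mxE => /eqP.
  by rewrite nth_uniq// => /eqP /val_inj.
have sub : {subset A <= [seq row phi | phi <- enum {: {ffun 'I_m -> 'I_(size s)}}]}.
  move=> k kA.
  have ks i : k 0 i \in s.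
    rewrite mem_undup; apply/flattenP.
    exists [seq k 0 i | i <- enum 'I_m]; first by apply/mapP; exists k.
    by apply/mapP; exists i => //; rewrite mem_enum.
  have ki (i : 'I_m) : (index (k 0%R i) s < size s)%N by rewrite index_mem.
  apply/mapP; exists [ffun i => Ordinal (ki i)]; first by rewrite mem_enum.
  by apply/rowP => i; rewrite mxE ffunE/= nth_index.
apply: le_trans (sum_subset_le uA _ sub _) _ => [|k|].
- by rewrite map_inj_uniq// enum_uniq.
- exact: expR_ge0.
rewrite big_map big_enum/=.
have -> : \sum_phi expR (- b * \sum_i `|(row phi 0 i)%:~R : R| `^ p) =
    \prod_(i < m) \sum_(j < size s) w (nth 0 s j).
  rewrite bigA_distr_bigA/=; apply: eq_bigr => phi _.
  rewrite mulr_sumr expR_sum; apply: eq_bigr => i _.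
  by rewrite mxE.
rewrite prodr_const card_ord.
have -> : \sum_(j < size s) w (nth 0 s j) = \sum_(j <- s) w j.
  by rewrite (big_nth 0) big_mkord.
apply: lerXn2r; rewrite ?nnegrE//; last exact: sB.
by apply: sumr_ge0 => j _; exact: expR_ge0.
Qed.

End LatticeSums.

(** * Sums over arbitrary index sets *)

#[local] Existing Instance totally_filter.

Section HasSum.
Context {R : realType} {I : choiceType}.
Implicit Types (F G : I -> R[i]^o) (A : {fset I}).

Lemma partial_sumE (V : zmodType) (h : I -> V) A :
  partial_sum h A = \sum_(i <- A) h i.
Proof. by rewrite /partial_sum big_seq_fsetE. Qed.

Lemma has_sumP F (S : R[i]) : has_sum F S <->
  forall e : R, 0 < e ->
    \forall A \near totally, normc (S - \sum_(i <- enum_fset A) F i) < e.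
Proof.
split=> [FS e e0|FS].
  have e0' : 0 < e%:C%C :> R[i] by rewrite ltcR.
  move/cvgrPdist_lt: FS => /(_ _ e0').
  by apply: filterS => A; rewrite partial_sumE ltcR.
apply/cvgrPdist_lt => -[a b]; rewrite ltcE/= => /andP[/eqP-> a0].
have := FS a a0; apply: filterS => A; rewrite partial_sumE => h.
by rewrite ltcR.
Qed.

Lemma has_sum_unique F (S T : R[i]) : has_sum F S -> has_sum F T -> S = T.
Proof. by move=> FS FT; exact: (cvg_unique (@norm_hausdorff _ R[i]^o) FS FT). Qed.

Lemma has_sum_lin F G (a S T : R[i]) : has_sum F S -> has_sum G T ->
  has_sum (fun i => a * F i + G i : R[i]^o) (a * S + T).
Proof.
move=> /has_sumP FS /has_sumP GT; apply/has_sumP => e e0.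
have na := normc_ge0 a.
have na2 : 0 < normc a + 1 + 1 by rewrite ltr_wpDl// addr_ge0.
pose d := e / (normc a + 1 + 1); have d0 : 0 < d by rewrite divr_gt0.
have := GT _ d0; have := FS _ d0; apply: filterS2 => A lF lG.
have -> : a * S + T - \sum_(i <- A) (a * F i + G i) =
    a * (S - \sum_(i <- A) F i) + (T - \sum_(i <- A) G i).
  by rewrite big_split/= -mulr_sumr; ring.
apply: le_lt_trans (le_normcD _ _) _; rewrite normcM.
have -> : e = normc a * d + (d + d) by rewrite /d; field; rewrite gt_eqF.
rewrite ler_ltD//; first by rewrite ler_wpM2l// ltW.
by rewrite (lt_trans lG)// ltrDl.
Qed.

Lemma has_sumZ F (a S : R[i]) : has_sum F S ->
  has_sum (fun i => a * F i : R[i]^o) (a * S).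
Proof.
move=> FS; have z0 : has_sum (fun _ : I => 0 : R[i]^o) 0.
  apply/has_sumP => e e0; near=> A.
  by rewrite big1// subr0 normc0.
have := has_sum_lin (a := a) FS z0; rewrite addr0.
by under eq_fun do rewrite addr0.
Unshelve. all: end_near. Qed.

(** The sum is the supremum of the finite partial sums. *)
Lemma nneg_partial_sums_cvg (h : I -> R) (B : R) : (forall i, 0 <= h i) ->
  (forall A, \sum_(i <- A) h i <= B) ->
  exists s, forall e, 0 < e ->
    \forall A \near totally, `|s - \sum_(i <- enum_fset A) h i| < e.
Proof.
move=> h0 hB; pose E := range (fun A => \sum_(i <- A) h i).
have ubE : has_ubound E by exists B => _ [A _ <-].
have supE : has_sup E.
  by split=> //; exists (\sum_(i <- fset0) h i); exists fset0.
exists (sup E) => e e0.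
have [_ [A0 _ <-] sA0] := sup_adherent e0 supE.
exists A0 => //= A A0A.
have le : \sum_(i <- A0) h i <= \sum_(i <- A) h i.
  rewrite [leRHS](bigID (mem A0))/=.
  have -> : \sum_(i <- A | i \in A0) h i = \sum_(i <- A0) h i.
    rewrite -big_filter; apply: perm_big; apply: uniq_perm.
    - by rewrite filter_uniq.
    - exact: fset_uniq.
    - move=> i; rewrite mem_filter; case: (boolP (i \in A0)) => //= iA0.
      by rewrite (fsubsetP A0A).
  by rewrite lerDl sumr_ge0.
have leS : \sum_(i <- A) h i <= sup E by apply: ub_le_sup => //; exists A.
rewrite ger0_norm ?subr_ge0// ltrBlDr -ltrBlDl.
exact: lt_le_trans sA0 le.
Qed.

(** The families |g| and g + |g| are nonnegative, and g is their difference. *)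
Lemma abs_partial_sums_cvg (g : I -> R) (B : R) :
  (forall A, \sum_(i <- A) `|g i| <= B) ->
  exists s, forall e, 0 < e ->
    \forall A \near totally, `|s - \sum_(i <- enum_fset A) g i| < e.
Proof.
move=> gB; have [s1 S1] := nneg_partial_sums_cvg (fun i => normr_ge0 (g i)) gB.
have [i|A|s2 S2] := @nneg_partial_sums_cvg (fun i => g i + `|g i|) (B + B).
- by rewrite -lerBlDr sub0r lerNl ler_normr lexx orbT.
- rewrite big_split/= lerD//; apply: le_trans (gB A).
  by apply: ler_sum => i _; exact: ler_norm.
exists (s2 - s1) => e e0; have e20 : 0 < e / 2 by rewrite divr_gt0.
have := S1 _ e20; have := S2 _ e20; apply: filterS2 => A.
rewrite big_split/= => h2 h1.
have -> : s2 - s1 - \sum_(i <- A) g i =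
   s2 - (\sum_(i <- A) g i + \sum_(i <- A) `|g i|) -
   (s1 - \sum_(i <- A) `|g i|) by ring.
by rewrite (le_lt_trans (ler_normB _ _))// [ltRHS]splitr ltrD.
Qed.

(** Absolutely summable complex families are summable. *)
Lemma has_sum_abs F (B : R) : (forall A, \sum_(i <- A) normc (F i) <= B) ->
  exists2 S : R[i], has_sum F S & normc S <= B.
Proof.
move=> FB.
have [A|s1 S1] := @abs_partial_sums_cvg (fun i => complex.Re (F i)) B.
  by apply: le_trans (FB A); apply: ler_sum => i _; exact: Re_le_normc.
have [A|s2 S2] := @abs_partial_sums_cvg (fun i => complex.Im (F i)) B.
  by apply: le_trans (FB A); apply: ler_sum => i _; exact: Im_le_normc.
have FS : has_sum F (s1 +i* s2)%C.
  apply/has_sumP => e e0; have e20 : 0 < e / 2 by rewrite divr_gt0.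
  have := S1 _ e20; have := S2 _ e20; apply: filterS2 => A h2 h1.
  apply: le_lt_trans (normc_le_ReIm _) _.
  rewrite Re_sub Im_sub (big_morph (@complex.Re R) (@Re_add R) erefl).
  rewrite (big_morph (@complex.Im R) (@Im_add R) erefl)/=.
  by rewrite [ltRHS]splitr ltrD.
exists (s1 +i* s2)%C => //; apply/ler_addgt0Pr => e e0.
have [A SA] := filter_ex ((has_sumP _ _).1 FS e e0).
rewrite -[X in normc X](subrK (\sum_(i <- A) F i)).
apply: le_trans (le_normcD _ _) _; rewrite addrC lerD ?(ltW SA)//.
apply: le_trans (FB A); elim/big_ind2: _ => //.
  by rewrite normc0.
by move=> x1 x2 y1 y2 l1 l2; apply: le_trans (le_normcD _ _) _; rewrite lerD.
Qed.

End HasSum.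

(** * Seminorms and decay of the Fourier coefficients *)

Section Weights.
Context {R : realType}.

(** An upper bound on a weighted supremum, spelled out termwise. *)
Lemma weighted_sup_ub (I X : Type) (w : I -> R) (g : I -> X -> R[i]) (M : R) :
  (forall i, 0 < w i) -> (weighted_sup w g <= M%:E)%E ->
  forall i x, w i * normc (g i x) <= M.
Proof.
move=> w0 wM i x; rewrite -lee_fin; apply: le_trans wM.
apply: (@le_trans _ _ ((w i)%:E *
    ereal_sup (range (fun x => (normc (g i x))%:E)))%E); last first.
  by apply: ereal_sup_ubound; exists i.
rewrite EFinM; apply: lee_wpmul2l; first by rewrite lee_fin ltW.
by apply: ereal_sup_ubound; exists x.
Qed.

Variables (m n : nat) (sigma mu : R).

(** The weight of the pair of multi-indices [ab] in the seminorm of S_mu. *)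
Definition gs_weight (C : R) (ab : mindex n * mindex n) : R :=
  C ^- (mabs ab.1 + mabs ab.2) * ((mfact ab.1 * mfact ab.2)%:R `^ (- mu)).

Lemma gs_weight_gt0 C ab : 0 < C -> 0 < gs_weight C ab.
Proof.
move=> C0; rewrite /gs_weight mulr_gt0 ?invr_gt0 ?exprn_gt0// powR_gt0//.
by rewrite ltr0n muln_gt0 !mfact_gt0.
Qed.

(** The weight together with the monomial: the factor in front of the
    x-derivative in the seminorms. *)
Definition gs_coef (C : R) (ab : mindex n * mindex n) (x : 'rV[R]_n) : R :=
  gs_weight C ab * `|mpow x ab.1|.

Lemma gs_coef_ge0 C ab x : 0 < C -> 0 <= gs_coef C ab x.
Proof. by move=> C0; rewrite mulr_ge0// ltW// gs_weight_gt0. Qed.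

Lemma gs_norm_le C (f : 'rV[R]_n -> R[i]^o) (M : R) : 0 < C ->
  (forall ab x, gs_coef C ab x * normc (cderivs (mdirs id ab.2) f x) <= M) ->
  (gs_norm mu C f <= M%:E)%E.
Proof.
move=> C0 fM; apply: weighted_sup_le => [ab|ab x].
  exact: gs_weight_gt0.
by rewrite normcM normc_real mulrA; exact: fM.
Qed.

Lemma mdirs_map p d (e : 'I_p -> 'I_d) (b : mindex p) :
  mdirs e b = map e (mdirs id b).
Proof.
rewrite /mdirs map_flatten -map_comp; congr flatten.
by apply: eq_map => i /=; rewrite map_nseq.
Qed.

(** The multi-index with the single entry [r] at [i]. *)
Definition mindex1 p (i : 'I_p) (r : nat) : mindex p :=
  [ffun j => if j == i then r else 0%N].

Lemma mdirs_mindex1 p d (e : 'I_p -> 'I_d) i r :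
  mdirs e (mindex1 i r) = nseq r (e i).
Proof.
rewrite /mdirs; have := enum_uniq 'I_p; have := mem_enum 'I_p i.
elim: (enum 'I_p) => //= j s IH; rewrite inE => js /andP[njs us].
rewrite ffunE; have [ji|ji] := eqVneq j i; last first.
  by apply: IH => //; move: js; rewrite eq_sym (negbTE ji).
rewrite ji in njs *.
rewrite [X in _ ++ X](_ : _ = [::]) ?cats0//.
have : {in s, forall l, mindex1 i r l = 0%N}.
  by move=> l ls; rewrite ffunE; case: eqP => // li; rewrite -li ls in njs.
elim: s {IH js njs us} => //= l s IH sl.
rewrite sl ?inE ?eqxx//=; apply: IH => l' l's; apply: sl.
by rewrite inE l's orbT.
Qed.

Lemma mabs_mindex1 p (i : 'I_p) r : mabs (mindex1 i r) = r.
Proof.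
rewrite /mabs (bigD1 i)//= ffunE eqxx big1 ?addn0// => j ji.
by rewrite ffunE (negbTE ji).
Qed.

Lemma mfact_mindex1 p (i : 'I_p) r : mfact (mindex1 i r) = r`!.
Proof.
rewrite /mfact (bigD1 i)//= ffunE eqxx big1 ?muln1// => j ji.
by rewrite ffunE (negbTE ji).
Qed.

(** The weights of the seminorms on S_(sigma, mu) and on S_mu differ by the
    factor C ^ |c| c!^sigma, where c is the order of derivation in t. *)
Lemma tgs_norm_ub C (f : 'rV[R]_(m + n) -> R[i]^o) (M : R) a b c z : 0 < C ->
  (tgs_norm sigma mu C f <= M%:E)%E ->
  gs_coef C (a, b) (rsubmx z) * normc (cderivs
    (map (@rshift m n) (mdirs id b) ++ mdirs (@lshift m n) c) f z)
  <= M * C ^+ mabs c * (mfact c)%:R `^ sigma.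
Proof.
move=> C0 fM.
pose w (abc : mindex n * mindex n * mindex m) : R :=
  C ^- (mabs abc.1.1 + mabs abc.1.2 + mabs abc.2)
       * ((mfact abc.2)%:R `^ (- sigma))
       * ((mfact abc.1.1 * mfact abc.1.2)%:R `^ (- mu)).
have w0 abc : 0 < w abc.
  by rewrite /w !mulr_gt0 ?invr_gt0 ?exprn_gt0 ?powR_gt0 ?ltr0n
       ?muln_gt0 ?mfact_gt0.
have := weighted_sup_ub w0 fM (a, b, c) z.
rewrite normcM normc_real mdirs_map /w.
rewrite -[(a, b, c).1.1]/a -[(a, b, c).1.2]/b -[(a, b, c).2]/c.
set N := normc (cderivs _ _ _) => le.
have Cc : 0 < C ^+ mabs c by exact: exprn_gt0.
have F0 : 0 < (mfact c)%:R `^ sigma :> R by rewrite powR_gt0// ltr0n mfact_gt0.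
rewrite -!ler_pdivrMr//; apply: le_trans le.
rewrite /gs_coef /gs_weight -[(a, b).1]/a -[(a, b).2]/b !powRN !exprD !invfM.
rewrite le_eqVlt; apply/orP; left; apply/eqP; ring.
Qed.

(** The case without derivatives in t. *)
Lemma tgs_norm_ub0 C (f : 'rV[R]_(m + n) -> R[i]^o) (M : R) ab t x : 0 < C ->
  (tgs_norm sigma mu C f <= M%:E)%E ->
  gs_coef C ab x * normc (cderivs (map (@rshift m n) (mdirs id ab.2)) f
    (row_mx t x)) <= M.
Proof.
case: ab => a b C0 fM; pose c : mindex m := [ffun => 0%N].
have := tgs_norm_ub a b c (row_mx t x) C0 fM.
rewrite row_mxKr.
have -> : mdirs (@lshift m n) c = [::].
  rewrite /mdirs; elim: (enum 'I_m) => //= i s IH.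
  by rewrite ffunE/= IH.
have -> : mabs c = 0%N by rewrite /mabs big1// => i _; rewrite ffunE.
have -> : mfact c = 1%N by rewrite /mfact big1// => i _; rewrite ffunE.
by rewrite cats0 expr0 mulr1 powR1 mulr1.
Qed.

(** The case of [r] derivatives in the same variable t_i. *)
Lemma tgs_norm_ub1 C (f : 'rV[R]_(m + n) -> R[i]^o) (M : R) ab i r t x : 0 < C ->
  (tgs_norm sigma mu C f <= M%:E)%E ->
  gs_coef C ab x * normc (cderivs
    (map (@rshift m n) (mdirs id ab.2) ++ nseq r (lshift n i)) f (row_mx t x))
  <= M * C ^+ r * r`!%:R `^ sigma.
Proof.
case: ab => a b C0 fM.
have := tgs_norm_ub a b (mindex1 i r) (row_mx t x) C0 fM.
by rewrite row_mxKr mdirs_mindex1 mabs_mindex1 mfact_mindex1.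
Qed.

Lemma GS_intro C (f : 'rV[R]_n -> R[i]^o) (M : R) : 0 < C -> smooth f ->
  (gs_norm mu C f <= M%:E)%E -> f \in @GS R n mu.
Proof.
move=> C0 sf fM; rewrite inE; split => //; exists C => //.
by apply: le_lt_trans fM _; exact: ltry.
Qed.

End Weights.

Section CoefficientDecay.
Context {R : realType}.
Variables (m n : nat) (sigma mu : R).
Hypothesis sigma_gt0 : 0 < sigma.

(** The rate b and the constant in the decay of the Fourier coefficients: the
    seminorm with parameter C of the coefficient at - k is at most
    [decay_cst] M exp (- [decay_rate C] S(k)), where S(k) is the sum of the
    |k_i| ^ (1 / sigma), if that of f is at most M. *)
Definition decay_rate (C : R) : R :=
  sigma / 2 * C^-1 `^ sigma^-1 / m.+1%:R.

Definition decay_cst : R := 2 `^ sigma * (2 * (2 * pi) ^+ m).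

Lemma decay_rate_gt0 C : 0 < C -> 0 < decay_rate C.
Proof.
by move=> C0; rewrite !divr_gt0 ?mulr_gt0 ?powR_gt0 ?invr_gt0.
Qed.

Lemma decay_cst_ge0 : 0 <= decay_cst.
Proof. by rewrite !mulr_ge0 ?powR_ge0// exprn_ge0// ltW// pi2_gt0. Qed.

(** The Fourier coefficients of a Gevrey function of order sigma in the torus
    variables decay exponentially in the |k_i| ^ (1 / sigma), for the seminorm
    with the same parameter. *)
Lemma gs_norm_torus_coef_le C (f : 'rV[R]_(m + n) -> R[i]^o) (M : R)
    (k : 'rV[int]_m) :
  smooth f -> Defs.periodic f -> 0 < C -> (tgs_norm sigma mu C f <= M%:E)%E ->
  (gs_norm mu C (torus_coef f k) <=
   (decay_cst * M * expR (- decay_rate C * \sum_i `|(k 0 i)%:~R| `^ sigma^-1))%:E)%E.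
Proof.
move=> sf pf C0 fM; apply: gs_norm_le => // ab x.
have b0 t := tgs_norm_ub0 ab t x C0 fM.
have b1 i r t := tgs_norm_ub1 ab i r t x C0 fM.
move: (gs_coef_ge0 mu ab x C0) b0 b1; move: (gs_coef mu C ab x) => c c0 b0 b1.
set D := _ * normc _; pose K : R := 2 * (2 * pi) ^+ m.
have K0 : 0 <= K by rewrite mulr_ge0// exprn_ge0// ltW// pi2_gt0.
have D0 : 0 <= D by rewrite mulr_ge0// normc_ge0.
have DKM : D <= K * M.
  rewrite /D cderivs_torus_coef//; apply: torus_integral_weighted_le => //.
    exact: ccontinuous_twisted_slice (smooth_cderivs _ sf).
  by move=> t; rewrite /twisted_slice normcM normc_expi mulr1; exact: b0.
have M0 : 0 <= M.
  by apply: le_trans (b0 0); rewrite mulr_ge0// normc_ge0.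
have Dir i r : `|(k 0 i)%:~R| ^+ r * D <= K * M * C ^+ r * r`!%:R `^ sigma.
  rewrite /D mulrCA torus_coef_iter_by_parts//.
  have -> : K * M * C ^+ r * r`!%:R `^ sigma =
    K * (M * C ^+ r * r`!%:R `^ sigma) by ring.
  apply: torus_integral_weighted_le => //.
    exact: ccontinuous_twisted_slice (smooth_cderivs _ sf).
  by move=> t; rewrite /twisted_slice normcM normc_expi mulr1; exact: b1.
have s2 : 1 <= 2 `^ sigma :> R.
  by have := @ler_powR R 2 (ler1n _ 2) 0 sigma (ltW sigma_gt0); rewrite powRr0.
pose y i : R := `|(k 0 i)%:~R| `^ sigma^-1.
have c1 : 0 < sigma / 2 * C^-1 `^ sigma^-1.
  by rewrite mulr_gt0 ?divr_gt0// powR_gt0// invr_gt0.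
have := @expR_average_le R 'I_m y (2 `^ sigma * (K * M)) D _ c1.
rewrite card_ord /decay_rate /decay_cst mulrA; apply.
- exact: mulr_ge0 (mulr_ge0 (powR_ge0 _ _) K0) M0.
- by move=> i; exact: powR_ge0.
- apply: le_trans DKM _; rewrite -mulrA ler_peMl//; exact: mulr_ge0.
move=> i; have := factorial_bounds_decay sigma_gt0 C0 (normr_ge0 _) D0 (Dir i).
have CV0 : 0 <= C^-1 by rewrite invr_ge0 ltW.
have -> : - (sigma / 2) * (`|(k 0 i)%:~R| / C) `^ sigma^-1 =
    - (sigma / 2 * C^-1 `^ sigma^-1) * y i.
  by rewrite (powRM _ (normr_ge0 _) CV0) /y; ring.
by rewrite mulrA.
Qed.

End CoefficientDecay.

(** * Functionals and integrals *)

Section Pairing.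
Context {R : realType}.
Variables (n : nat) (mu : R).
Implicit Types u : gs n mu -> R[i]^o.

Lemma gs_valB (f g : gs n mu) : gs_val (f - g) = gs_val f - gs_val g.
Proof. exact: (@raddfB _ _ (val : gs n mu -> 'rV[R]_n -> R[i]^o)). Qed.

Lemma gs_valD (f g : gs n mu) : gs_val (f + g) = gs_val f + gs_val g.
Proof. exact: (@raddfD _ _ (val : gs n mu -> 'rV[R]_n -> R[i]^o)). Qed.

Lemma gs_valZ (a : R[i]) (f : gs n mu) : gs_val (a *: f) = a *: gs_val f.
Proof. reflexivity. Qed.

(** On elements of the test space, the pairing is the value of the functional. *)
Lemma gs_pairingE u (g : gs n mu) : gs_pairing u g = u g.
Proof.
rewrite /gs_pairing; congr u; apply: val_inj.
by rewrite insubdK//; exact: valP g.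
Qed.

Lemma gs_pairing_lin u (a : R[i]) (f g : 'rV[R]_n -> R[i]^o) : linear u ->
  f \in @GS R n mu -> g \in @GS R n mu ->
  gs_pairing u (a *: f + g) = a * gs_pairing u f + gs_pairing u g.
Proof.
move=> lu fG gG.
have := lu a (MkGs fG) (MkGs gG); rewrite -!gs_pairingE.
by rewrite gs_valD gs_valZ.
Qed.

Lemma gs_pairingZ u (a : R[i]) (f : 'rV[R]_n -> R[i]^o) : linear u ->
  f \in @GS R n mu -> gs_pairing u (a *: f) = a * gs_pairing u f.
Proof.
move=> lu fG; have zG : (0 : 'rV[R]_n -> R[i]^o) \in @GS R n mu by exact: rpred0.
have u0 : gs_pairing u 0 = 0.
  have := gs_pairing_lin 1 lu zG zG; rewrite scale1r mul1r addr0 => /eqP.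
  by rewrite -subr_eq subrr eq_sym => /eqP.
by have := gs_pairing_lin a lu fG zG; rewrite u0 !addr0.
Qed.

End Pairing.

Section Lipschitz.
Context {R : realType}.

(** A function that is Lipschitz in each coordinate is continuous: a translation
    is a finite sequence of translations along the axes. *)
Lemma lipschitz_ccontinuous m (q : 'rV[R]_m -> R[i]) (L : R) : 0 <= L ->
  (forall i h t, normc (q (h *: delta_mx 0 i + t) - q t) <= L * `|h|) ->
  ccontinuous q.
Proof.
move=> L0 qL.
have qS (v t : 'rV[R]_m) : normc (q (v + t) - q t) <= L * \sum_i `|v 0 i|.
  rewrite {1}[v]row_sum_delta.
  elim: (index_enum _) => [|i s IH].
    by rewrite !big_nil add0r subrr normc0 mulr0.
  rewrite !big_cons -addrA mulrDr.
  rewrite -(subrKA (q (\sum_(j <- s) v 0 j *: delta_mx 0 j + t))).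
  exact: le_trans (le_normcD _ _) (lerD (qL _ _ _) IH).
have cq (p : R[i] -> R) : (forall z w, `|p z - p w| <= normc (z - w)) ->
    continuous (fun t => p (q t)).
  move=> pL t; apply/(@cvgrPdist_lt _ _ _ (nbhs t) (nbhs_filter t)) => e e0.
  have K0 : 0 < L * m%:R + 1 by rewrite ltr_wpDl// mulr_ge0.
  have r0 : 0 < e / (L * m%:R + 1) by rewrite divr_gt0.
  apply/nbhs_ballP; exists (e / (L * m%:R + 1)) => //= s [_ st].
  have := qS (t - s) s; rewrite subrK => le.
  apply: le_lt_trans (le_trans (pL _ _) le) _.
  apply: (@le_lt_trans _ _ (L * (m%:R * (e / (L * m%:R + 1))))).
    rewrite ler_wpM2l//.
    have -> : m%:R * (e / (L * m%:R + 1)) = \sum_(i < m) e / (L * m%:R + 1).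
      by rewrite sumr_const card_ord mulr_natl.
    apply: ler_sum => i _; rewrite !mxE; exact: ltW (st 0 i).
  rewrite !mulrA ltr_pdivrMr// mulrDr mulr1 mulrC ltrDl//.
by split; apply: cq => z w; [rewrite -Re_sub; exact: Re_le_normc|
  rewrite -Im_sub; exact: Im_le_normc].
Qed.

End Lipschitz.

Section Interchange.
Context {R : realType}.
Variables (m n : nat) (mu : R).

Lemma le_div_all_le0 (x c : R) : (forall N, (0 < N)%N -> x <= c / N%:R) -> x <= 0.
Proof.
move=> xc; rewrite leNgt; apply/negP => x0.
pose N := (Num.truncn (c / x)).+1.
have := xc N isT; rewrite ler_pdivlMr ?ltr0n// leNgt => /negP; apply.
by rewrite mulrC -ltr_pdivrMr// truncnS_gt.
Qed.

(** A functional that is bounded for one seminorm may be moved inside the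
    integral of a family that is Lipschitz for this seminorm: both sides are
    limits of the same Riemann sums. *)
Lemma functional_torus_integral (u : gs n mu -> R[i]^o) (A C L : R)
    (Phi : 'rV[R]_m -> gs n mu) (psi : gs n mu) :
  linear u -> 0 <= A -> 0 < C -> 0 <= L ->
  (forall g, ((normc (u g))%:E <= A%:E * gs_norm mu C g)%E) ->
  csmooth_family (fun t => Phi t) ->
  (forall x, psi x = torus_integral (fun t => Phi t x)) ->
  (forall ab x i h t, gs_coef mu C ab x *
     normc (cderivs (mdirs id ab.2) (Phi (h *: delta_mx 0 i + t)) x -
            cderivs (mdirs id ab.2) (Phi t) x) <= L * `|h|) ->
  u psi = torus_integral (fun t => u (Phi t)).
Proof.
move=> lu A0 C0 L0 uA sP psiE PL.
have ub (g : gs n mu) (M : R) : (gs_norm mu C g <= M%:E)%E -> normc (u g) <= A * M.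
  move=> gM; rewrite -lee_fin EFinM; apply: le_trans (uA g) _.
  by apply: lee_wpmul2l => //; rewrite lee_fin.
have smooth_gs (g : gs n mu) : smooth g.
  by have := valP g; rewrite inE => -[].
have uB (g h : gs n mu) : u (g - h) = u g - u h.
  have := lu (-1) h g; rewrite scaleN1r [- h + g]addrC => ->.
  by rewrite scaleN1r addrC.
have u0 : u 0 = 0 by rewrite -(subrr 0) uB subrr.
have uZ a (g : gs n mu) : u (a *: g) = a * u g.
  by have := lu a g 0; rewrite u0 !addr0.
have uD (g h : gs n mu) : u (g + h) = u g + u h.
  by have := lu 1 g h; rewrite !scale1r.
have qL i h t : normc (u (Phi (h *: delta_mx 0 i + t)) - u (Phi t)) <=
    A * L * `|h|.
  rewrite -uB -mulrA; apply: ub; apply: gs_norm_le => // ab x.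
  by rewrite gs_valB cderivsB//; exact: PL.
have AL0 : 0 <= A * L by exact: mulr_ge0.
have cq : ccontinuous (fun t => u (Phi t)) := lipschitz_ccontinuous AL0 qL.
set I := torus_integral _.
pose K : R := 2 * (m%:R * (2 * pi) ^+ m.+1).
suff : normc (u psi - I) <= 0.
  move=> h; apply/eqP; rewrite -subr_eq0; apply/eqP/eq0_normc/eqP.
  by rewrite eq_le h normc_ge0.
apply: (@le_div_all_le0 _ (A * (K * L) + K * (A * L))) => N N0.
pose c : R[i] := ((2 * pi / N%:R) ^+ m)%:C%C; pose S := grid_sum N Phi.
have uS : u S = grid_sum N (fun t => u (Phi t)).
  by rewrite /S (grid_sum_morph (f := u)).
(* [c *: S] is the Riemann sum of [Phi]; both differences are O(1 / N). *)
have -> : u psi - I = u (psi - c *: S) + - (I - c * u S).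
  by rewrite uB uZ; ring.
apply: le_trans (le_normcD _ _) _; rewrite normcN mulrDl lerD//; last first.
  by rewrite uS; exact: torus_Riemann_sum.
rewrite -!mulrA; apply: ub; apply: gs_norm_le => // ab x.
rewrite gs_valB gs_valZ cderivsB//; last exact: smoothZ.
rewrite cderivsZ//.
set s := mdirs _ _; set w := gs_coef _ _ _ _.
have w0 : 0 <= w by exact: gs_coef_ge0.
have [sT cT] := cderivs_torus_integral sP.
have -> : cderivs s psi x = torus_integral (fun t => cderivs s (Phi t) x).
  by rewrite -cT; congr cderivs; apply/funext => y; exact: psiE.
have -> : cderivs s S x = grid_sum N (fun t => cderivs s (Phi t) x).
  rewrite /S (grid_sum_morph (f := fun g : gs n mu => cderivs s g x)) => [//||g h].
    exact: cderivs0.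
  by rewrite gs_valD (cderivsD s x (smooth_gs g) (smooth_gs h)).
pose g t := w%:C%C * cderivs s (Phi t) x.
have cP : ccontinuous (fun t => cderivs s (Phi t) x).
  exact: (csmooth_family_continuous s x sP).
have cg : ccontinuous g.
  apply: ccontinuousM => //; split; exact: cst_continuous.
have gL i h t : normc (g (h *: delta_mx 0 i + t) - g t) <= L * `|h|.
  by rewrite -mulrBr normcM normc_real ger0_norm//; exact: PL.
have := torus_Riemann_sum N0 cg L0 gL.
have -> : torus_integral g = w%:C%C * torus_integral (fun t => cderivs s (Phi t) x).
  have c0 : ccontinuous (fun _ : 'rV[R]_m => 0 : R[i]).
    by split; exact: cst_continuous.
  have t0 : torus_integral (fun _ : 'rV[R]_m => 0 : R[i]) = 0.
    apply/eq0_normc/eqP; rewrite eq_le normc_ge0 andbT.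
    rewrite -[leRHS](mulr0 (2 * (2 * pi) ^+ m)).
    by apply: torus_integral_normc_le => // t; rewrite normc0.
  have := torus_integral_lin w%:C%C cP c0; rewrite t0 addr0 => <-.
  by congr torus_integral; apply/funext => t; rewrite addr0.
have -> : grid_sum N g = w%:C%C * grid_sum N (fun t => cderivs s (Phi t) x).
  rewrite (grid_sum_morph (f := fun z => w%:C%C * z))//; first by rewrite mulr0.
  by move=> ? ?; rewrite mulrDr.
rewrite -/c mulrCA -mulrBr normcM normc_real ger0_norm// /K.
by rewrite !mulrA.
Qed.

End Interchange.

(** * Synthesis of the functional *)

Section TwistedSlices.
Context {R : realType}.
Variables (m n : nat) (sigma mu : R).

Lemma gs_norm_twisted_slice_le C (f : 'rV[R]_(m + n) -> R[i]^o) (M : R) k t :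
  smooth f -> 0 < C -> (tgs_norm sigma mu C f <= M%:E)%E ->
  (gs_norm mu C (twisted_slice f k t) <= M%:E)%E.
Proof.
move=> sf C0 fM; apply: gs_norm_le => // ab x.
rewrite cderivs_twisted_slice// /twisted_slice normcM normc_expi mulr1.
exact: tgs_norm_ub0 C0 fM.
Qed.

Lemma gs_norm_slice_le C (f : 'rV[R]_(m + n) -> R[i]^o) (M : R) t :
  smooth f -> 0 < C -> (tgs_norm sigma mu C f <= M%:E)%E ->
  (gs_norm mu C (fun x => f (row_mx t x)) <= M%:E)%E.
Proof.
move=> sf C0 fM; apply: gs_norm_le => // ab x.
rewrite cderivs_row_mx//; exact: tgs_norm_ub0 C0 fM.
Qed.

(** The twisted slices are Lipschitz functions of t for the seminorm of parameter
    C: the first term of the constant bounds the variation of f, the second one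
    that of the character. *)
Lemma twisted_slice_lipschitz C (f : 'rV[R]_(m + n) -> R[i]^o) (M : R)
    (k : 'rV[int]_m) ab x i h t :
  smooth f -> 0 < C -> (tgs_norm sigma mu C f <= M%:E)%E ->
  gs_coef mu C ab x *
    normc (cderivs (mdirs id ab.2) (twisted_slice f k (h *: delta_mx 0 i + t)) x
           - cderivs (mdirs id ab.2) (twisted_slice f k t) x)
  <= (2 * (M * C) + M * (2 * \sum_j `|(k 0 j)%:~R|)) * `|h|.
Proof.
move=> sf C0 fM; rewrite !cderivs_twisted_slice//.
have b0 t' := tgs_norm_ub0 ab t' x C0 fM.
have b1 t' := tgs_norm_ub1 ab i 1 t' x C0 fM.
move: (gs_coef_ge0 mu ab x C0) b0 b1; move: (gs_coef mu C ab x) => c c0 b0 b1.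
set F := (cderivs _ f : _ -> R[i]^o).
have sF : smooth F by exact: smooth_cderivs.
have FL : c * normc (F (row_mx (h *: delta_mx 0 i + t) x) - F (row_mx t x)) <=
    2 * (M * C) * `|h|.
  rewrite row_mx_addl_delta; apply: lipschitz_cderivs => // a.
  rewrite -row_mx_addl_delta /F -cderivs_cat cderivs_catC//.
  by have := b1 (a *: delta_mx 0 i + t); rewrite expr1 (_ : 1`! = 1)%N// powR1 mulr1.
have F0 : c * normc (F (row_mx t x)) <= M by exact: b0.
rewrite /twisted_slice; set e' := expi _; set e := expi (zdot k t).
set F1 := F (row_mx (_ + _) x) in FL *; set F2 := F (row_mx t x) in FL F0 *.
have -> : F1 * e' - F2 * e = (F1 - F2) * e' + F2 * (e' - e) by ring.
apply: le_trans (ler_wpM2l c0 (le_normcD _ _)) _.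
rewrite !normcM normc_expi mulr1 mulrDr mulrDl lerD//.
rewrite [leLHS]mulrA -[leRHS]mulrA.
have M0 : 0 <= M by apply: le_trans F0; rewrite mulr_ge0// normc_ge0.
apply: ler_pM => //; [by rewrite mulr_ge0// normc_ge0|exact: normc_ge0|].
apply: le_trans (expi_lipschitz _ _) _.
rewrite zdot_addl addrK normrM -mulrA ler_wpM2l// ler_wpM2r//.
by rewrite (bigD1 i)//= lerDl sumr_ge0.
Qed.

Lemma tgs_valB (f g : tgs m n sigma mu) : tgs_val (f - g) = tgs_val f - tgs_val g.
Proof. reflexivity. Qed.

Lemma tgs_val_lin (a : R[i]) (f g : tgs m n sigma mu) :
  tgs_val (a *: f + g) = a *: tgs_val f + tgs_val g.
Proof. reflexivity. Qed.

Lemma tgsP (f : tgs m n sigma mu) : smooth f /\ Defs.periodic f.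
Proof. by have := valP f; rewrite inE => -[]. Qed.

Lemma lty_le_EFin (x : \bar R) : (x < +oo)%E -> exists M : R, (x <= M%:E)%E.
Proof.
by case: x => [r _||_] //; [exists r|exists 0; exact: leNye].
Qed.

Lemma tgs_norm_bounded (f : tgs m n sigma mu) :
  exists C M : R, 0 < C /\ (tgs_norm sigma mu C f <= M%:E)%E.
Proof.
have := valP f; rewrite inE => -[_ _ [C C0 /lty_le_EFin[M fM]]].
by exists C, M.
Qed.

End TwistedSlices.

Section Synthesis.
Context {R : realType}.
Variables (m n : nat) (sigma mu : R).
Hypothesis sigma_ge1 : 1 <= sigma.
Variable u : 'rV[int]_m -> gs n mu -> R[i]^o.
Hypothesis u_lin : forall k, linear (u k).
Hypothesis u_bound : forall C1 eps : R, 0 < C1 -> 0 < eps ->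
  exists2 C0 : R, 0 < C0 &
    forall (f : gs n mu) (k : 'rV[int]_m),
      ((normc (u k f))%:E <= C0%:E * gs_norm mu C1 f
         * (expR (eps * znorm k `^ sigma^-1))%:E)%E.

Let sigma_gt0 : 0 < sigma := lt_le_trans ltr01 sigma_ge1.

(** The common terms of the two series, k |-> < u k, c_k >, where c_k is
    [torus_coef f k]. *)
Definition pairing_coef (f : 'rV[R]_(m + n) -> R[i]^o) (k : 'rV[int]_m) :
  R[i]^o := gs_pairing (u k) (torus_coef f k).

Lemma torus_coef_GS C (f : 'rV[R]_(m + n) -> R[i]^o) (M : R) k :
  smooth f -> Defs.periodic f -> 0 < C -> (tgs_norm sigma mu C f <= M%:E)%E ->
  torus_coef f k \in @GS R n mu.
Proof.
move=> sf pf C0 fM; have := gs_norm_torus_coef_le sigma_gt0 k sf pf C0 fM.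
by apply: GS_intro => //; exact: smooth_torus_coef.
Qed.

(** The growth of [u k] is absorbed by the decay of the coefficients. *)
Lemma sum_pairing_coef_le C : 0 < C -> exists2 K : R, 0 <= K &
  forall (f : 'rV[R]_(m + n) -> R[i]^o) (M : R),
    smooth f -> Defs.periodic f -> (tgs_norm sigma mu C f <= M%:E)%E ->
    forall A : {fset 'rV[int]_m},
      \sum_(k <- A) normc (pairing_coef f k) <= K * M.
Proof.
move=> C0.
have dec (f : 'rV[R]_(m + n) -> R[i]^o) (M : R) k :=
  @gs_norm_torus_coef_le R m n sigma mu sigma_gt0 C f M k.
have b0 : 0 < decay_rate m sigma C by exact: decay_rate_gt0.
have q0 := decay_cst_ge0 (R := R) m sigma.
move: b0 q0 dec; move: (decay_rate m sigma C) (decay_cst m sigma).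
move=> b q b0 q0 dec.
(* Half of the rate [b] absorbs the growth of [u k]; the other half is left for
   the summation over the lattice. *)
have b20 : 0 < b / 2 by rewrite divr_gt0.
have p0 : 0 < sigma^-1 by rewrite invr_gt0.
have p1 : sigma^-1 <= 1 by rewrite invf_le1.
have [D D0 uD] := u_bound C0 b20.
have [B B0 sB] := @sum_exp_lattice R m (b / 2) sigma^-1 b20 p0.
have K0 : 0 <= D * q by rewrite mulr_ge0// ltW.
exists (D * q * B) => [|f M sf pf fM A].
  exact: mulr_ge0.
have M0 : 0 <= M.
  apply: le_trans (tgs_norm_ub0 ([ffun => 0%N], [ffun => 0%N]) 0 0 C0 fM).
  by rewrite mulr_ge0 ?normc_ge0// gs_coef_ge0.
apply: (@le_trans _ _ (\sum_(k <- A) D * q * M *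
    expR (- (b / 2) * \sum_i `|(k 0 i)%:~R| `^ sigma^-1))); last first.
  rewrite -mulr_sumr mulrAC ler_wpM2r// ler_wpM2l//; apply: sB.
  exact: fset_uniq.
apply: ler_sum => k _; set S := \sum_i _.
have tG := torus_coef_GS k sf pf C0 fM.
rewrite /pairing_coef -[torus_coef f k]/(gs_val (MkGs tG)) gs_pairingE.
rewrite -lee_fin; apply: le_trans (uD _ _) _.
apply: (@le_trans _ _ (D%:E * (q * M * expR (- b * S))%:E *
    (expR (b / 2 * znorm k `^ sigma^-1))%:E)%E).
  apply: lee_wpmul2r; first by rewrite lee_fin expR_ge0.
  apply: lee_wpmul2l; first by rewrite lee_fin ltW.
  exact: dec.
rewrite -!EFinM lee_fin -!mulrA -expRD !mulrA ler_wpM2l//.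
  exact: mulr_ge0.
rewrite ler_expR.
have := ler_wpM2l (ltW b20) (znorm_powR_le k p0 p1); rewrite -/S => le.
apply: le_trans (lerD (lexx _) le) _.
by rewrite le_eqVlt; apply/orP; left; apply/eqP; field.
Qed.

(** The functional [u k] commutes with the integral over the torus. *)
Lemma torus_integral_pairing C (f : 'rV[R]_(m + n) -> R[i]^o) (M : R) k :
  smooth f -> Defs.periodic f -> 0 < C -> (tgs_norm sigma mu C f <= M%:E)%E ->
  torus_integral (fun t =>
    gs_pairing (u k) (fun x => f (row_mx t x)) * expi (zdot k t)) =
  pairing_coef f k.
Proof.
move=> sf pf C0 fM.
have sl t := csmooth_family_smooth t (csmooth_family_row_mx sf).
have slG t : (fun x => f (row_mx t x)) \in @GS R n mu.
  exact: GS_intro C0 (sl t) (gs_norm_slice_le t sf C0 fM).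
have twG t : twisted_slice f k t \in @GS R n mu.
  apply: GS_intro C0 _ (gs_norm_twisted_slice_le k t sf C0 fM).
  exact: (csmooth_family_smooth t (csmooth_twisted_slice k sf)).
have tG := torus_coef_GS k sf pf C0 fM.
have [D D0 uD] := u_bound C0 (@ltr01 R).
have M0 : 0 <= M.
  apply: le_trans (tgs_norm_ub0 ([ffun => 0%N], [ffun => 0%N]) 0 0 C0 fM).
  by rewrite mulr_ge0 ?normc_ge0// gs_coef_ge0.
pose A := D * expR (1 * znorm k `^ sigma^-1).
have A0 : 0 <= A by rewrite mulr_ge0 ?expR_ge0// ltW.
pose L := 2 * (M * C) + M * (2 * \sum_j `|(k 0 j)%:~R : R|).
have L0 : 0 <= L.
  by rewrite addr_ge0 ?mulr_ge0// ?(ltW C0)// sumr_ge0.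
have uA g : ((normc (u k g))%:E <= A%:E * gs_norm mu C g)%E.
  by apply: le_trans (uD g k) _; rewrite /A EFinM muleAC.
(* [L] is the Lipschitz constant of the twisted slices, and [A] bounds [u k] for
   the seminorm of parameter [C]. *)
have := @functional_torus_integral R m n mu (u k) A C L
  (fun t => MkGs (twG t)) (MkGs tG) (u_lin k) A0 C0 L0 uA
  (csmooth_twisted_slice k sf) (fun x => erefl).
rewrite -gs_pairingE => eq; rewrite /pairing_coef eq; last first.
  by move=> ab x i h t; exact: (twisted_slice_lipschitz k ab x i h t sf C0 fM).
congr torus_integral; apply/funext => t.
have twE : gs_val (MkGs (twG t)) = expi (zdot k t) *: (fun x => f (row_mx t x)).
  by apply/funext => x; exact: mulrC.
by rewrite -gs_pairingE twE (gs_pairingZ _ (u_lin k) (slG t)) mulrC.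
Qed.

Lemma pairing_coef_lin (a : R[i]) (f g : tgs m n sigma mu) k :
  pairing_coef (a *: f + g) k = a * pairing_coef f k + pairing_coef g k.
Proof.
have [sf pf] := tgsP f; have [sg pg] := tgsP g.
have [C [M [C0 fM]]] := tgs_norm_bounded f.
have [C' [M' [C'0 gM]]] := tgs_norm_bounded g.
rewrite /pairing_coef tgs_val_lin torus_coef_lin// gs_pairing_lin//.
- exact: torus_coef_GS C0 fM.
- exact: torus_coef_GS C'0 gM.
Qed.

Lemma pairing_coef_summable (f : tgs m n sigma mu) :
  exists S : R[i], has_sum (pairing_coef f) S.
Proof.
have [sf pf] := tgsP f; have [C [M [C0 fM]]] := tgs_norm_bounded f.
have [K _ /(_ f M sf pf fM) /has_sum_abs[S fS _]] := sum_pairing_coef_le C0.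
by exists S.
Qed.

(** The functional with prescribed Fourier coefficients. *)
Definition synthesis (f : tgs m n sigma mu) : R[i]^o :=
  sval (cid (pairing_coef_summable f)).

Lemma synthesisP (f : tgs m n sigma mu) :
  has_sum (pairing_coef f) (synthesis f).
Proof. exact: svalP (cid (pairing_coef_summable f)). Qed.

Lemma synthesis_linear : linear synthesis.
Proof.
move=> a f g; apply: (has_sum_unique (@synthesisP (a *: f + g))).
have -> : pairing_coef (a *: f + g) =
    fun k => a * pairing_coef f k + pairing_coef g k.
  by apply/funext => k; exact: pairing_coef_lin.
exact: has_sum_lin (@synthesisP f) (@synthesisP g).
Qed.

(** By linearity, continuity follows from the bound of the sum by the seminorm of
    the argument. *)
Lemma synthesis_dual : tgs_dual synthesis.
Proof.
split; first exact: synthesis_linear.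
move=> C F f C0 _ _ Ff; have [K K0 sK] := sum_pairing_coef_le C0.
have bnd (g : tgs m n sigma mu) (M : R) :
    (tgs_norm sigma mu C g <= M%:E)%E -> normc (synthesis g) <= K * M.
  move=> gM; have [sg pg] := tgsP g.
  have [S gS SM] := has_sum_abs (sK g M sg pg gM).
  by rewrite (has_sum_unique (@synthesisP g) gS).
have synthB (g h : tgs m n sigma mu) :
    synthesis (g - h) = synthesis g - synthesis h.
  have := synthesis_linear (-1) h g; rewrite scaleN1r [- h + g]addrC => ->.
  by rewrite scaleN1r addrC.
apply/cvgrPdist_lt => -[e ei]; rewrite ltcE/= => /andP[/eqP-> e0].
have K1 : 0 < K + 1 by rewrite ltr_wpDl.
have d0 : 0 < e / (K + 1) by rewrite divr_gt0.
have d0' : (0 < (e / (K + 1))%:E)%E by rewrite lte_fin.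
have small : \forall j \near \oo,
    (tgs_norm sigma mu C (F j - f)%R < (e / (K + 1))%:E)%E.
  exact: Ff _ (open_ereal_lt' d0').
apply: filterS small => j lt.
rewrite distrC -synthB ltcR.
apply: le_lt_trans (bnd _ (e / (K + 1)) _) _.
  by rewrite tgs_valB ltW.
by rewrite mulrA ltr_pdivrMr// mulrDr mulr1 mulrC ltrDl.
Qed.

End Synthesis.

Theorem proposition3p11 (R : realType) (m n : nat) (sigma mu : R)
    (sigma_ge1 : 1 <= sigma) (mu_ge : 2^-1 <= mu)
    (u : 'rV[int]_m -> gs n mu -> R[i]^o)
    (u_dual : forall k, gs_dual (u k))
    (u_bound : forall C1 eps : R, 0 < C1 -> 0 < eps ->
      exists2 C0 : R, 0 < C0 &
        forall (f : gs n mu) (k : 'rV[int]_m),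
          ((ComplexField.Normc.normc (u k f))%:E <=
           C0%:E * gs_norm mu C1 f
             * (expR (eps * znorm k `^ sigma^-1))%:E)%E) :
  exists! v : tgs m n sigma mu -> R[i]^o,
    tgs_dual v /\
    forall f : tgs m n sigma mu,
      (exists2 S : R[i],
         has_sum (fun k => gs_pairing (u k) (fourier_coef f (- k))) S &
         v f = ((2 * pi) ^+ m)%:C%C * S) /\
      has_sum (fun k => torus_integral (fun t =>
          gs_pairing (u k) (fun x => f (row_mx t x)) * expi (zdot k t)))
        (v f).
Proof.
have u_lin k : linear (u k) by have [] := u_dual k.
have integralE (f : tgs m n sigma mu) : (fun k => torus_integral (fun t =>
    gs_pairing (u k) (fun x => f (row_mx t x)) * expi (zdot k t))) =
    pairing_coef u f.
  have [sf pf] := tgsP f; have [C [M [C0 fM]]] := tgs_norm_bounded f.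
  apply/funext => k.
  exact: (torus_integral_pairing sigma_ge1 u_lin u_bound k sf pf C0 fM).
exists (synthesis sigma_ge1 u_bound); split=> [|w [_ wP]]; last first.
  apply/funext => f; have [_] := wP f; rewrite integralE => wf.
  exact: has_sum_unique (@synthesisP _ _ _ _ _ sigma_ge1 u u_bound f) wf.
split; first exact: synthesis_dual.
move=> f; rewrite integralE; split; last exact: synthesisP.
set v := synthesis _ _ _.
have p0 : (2 * pi) ^+ m != 0 :> R by rewrite expf_neq0// gt_eqF// pi2_gt0.
exists (((2 * pi) ^- m)%:C%C * v); last first.
  by rewrite mulrA -rmorphM/= divff// mul1r.
have -> : (fun k => gs_pairing (u k) (fourier_coef f (- k))) =
    (fun k => ((2 * pi) ^- m)%:C%C * pairing_coef u f k).
  have [sf pf] := tgsP f; have [C [M [C0 fM]]] := tgs_norm_bounded f.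
  apply/funext => k; rewrite fourier_coefE gs_pairingZ//.
  exact: (torus_coef_GS sigma_ge1 k sf pf C0 fM).
exact: has_sumZ (@synthesisP _ _ _ _ _ sigma_ge1 u u_bound f).
Qed.
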